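(* Let $D$ be an $n$-vertex semicomplete multipartite digraph with partite sets of sizes $n_1,\dots,n_p$ satisfying $2\max\{n_i : i\in[p]\}\le \left(\sum_{i=1}^p n_i\right)+1$. Let $c^{pc}_{\max}$ be the maximum cost of a 1-path-cycle factor in the symmetric (0,1)-digraph $\hat{D}$ of $D$, and let $\sigma^{hp}_{\max}$ be the maximum of $\sigma^+(P)$ over all Hamilton oriented paths $P$ in $D$. Then $\sigma^{hp}_{\max}=c^{pc}_{\max}$. Moreover, both $\sigma^{hp}_{\max}$ and a Hamilton oriented path $P$ in $D$ with $\sigma^+(P)=\sigma^{hp}_{\max}$ can be found in time polynomial in the size of $D$.
   Context: A semicomplete $p$-partite (multipartite) digraph ($p\ge 2$) is obtained from a complete $p$-partite graph by replacing each edge $\{x,y\}$ by the arc $xy$, the arc $yx$, or both arcs; its partite sets are the maximal independent sets. The underlying graph $U(D)$ of a digraph $D$ is obtained by forgetting arc orientations. An oriented path $P=v_1v_2\dots v_p$ in $D$ is a sequence of distinct vertices such that consecutive vertices are adjacent in $D$ (so $U(P)$ is a path of $U(D)$); it is Hamilton if it contains all vertices of $D$. The pair $v_i,v_{i+1}$ contributes a forward arc if $v_iv_{i+1}\in A(D)$ and a backward arc otherwise; $\sigma^+(P)$ denotes the number of forward arcs. A 1-path-cycle factor of a digraph $H$ is a spanning subdigraph consisting of one non-empty (directed) path and a possibly empty collection of (directed) cycles, all vertex-disjoint. The symmetric (0,1)-digraph $\hat{D}$ of $D$ is obtained from $D$ by assigning cost 1 to every arc of $D$ and adding, for every $xy\in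 A(D)$ with $yx\notin A(D)$, an arc $yx$ of cost 0; the cost of a subgraph of $\hat{D}$ is the sum of the costs of its arcs. *)

(* Defs.v *)
From mathcomp Require Import all_boot.

Set Implicit Arguments.
Unset Strict Implicit.
Unset Printing Implicit Defensive.

(** A digraph on the vertex set [V] is its arc relation [D : rel V]. *)

Section Digraphs.
Variables (V : finType) (D : rel V).

Definition underlying : rel V := [rel x y | D x y || D y x].

Definition partite_set p (part : V -> 'I_p) (i : 'I_p) : {set V} :=
  [set x | part x == i].

(** The second clause says that no partite set is empty; the third, that two
    vertices are joined by at least one arc exactly when they lie in different
    partite sets (so that there are no loops). *)
Definition semicomplete_multipartite p (part : V -> 'I_p) : Prop :=
  [/\ 2 <= p,
      forall i, partite_set part i != set0 &
      forall x y, underlying x y = (part x != part y)].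

Definition path_arcs (s : seq V) : seq (V * V) := zip s (behead s).
Definition cycle_arcs (s : seq V) : seq (V * V) := zip s (rot 1 s).

Definition hamilton_oriented_path (s : seq V) : bool :=
  [&& sorted underlying s, uniq s & [forall x, x \in s]].

Definition sigma_plus (s : seq V) : nat :=
  count (fun a => D a.1 a.2) (path_arcs s).

(** The arcs of the symmetric (0,1)-digraph and their costs. *)
Definition hat : rel V := [rel x y | D x y || (D y x && ~~ D x y)].
Definition hat_cost (a : V * V) : nat := if D a.1 a.2 then 1 else 0.

Definition digraph_size : nat := #|V| + #|[set a : V * V | D a.1 a.2]|.

End Digraphs.

Section PathCycleFactors.
Variable V : finType.

Record path_cycle := PathCycle { pc_path : seq V; pc_cycles : seq (seq V) }.

Definition pc_vertices (F : path_cycle) : seq V :=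
  pc_path F ++ flatten (pc_cycles F).

Definition pc_arcs (F : path_cycle) : seq (V * V) :=
  path_arcs (pc_path F) ++ flatten [seq cycle_arcs c | c <- pc_cycles F].

(** Directed cycles of a digraph have length at least 2. *)
Definition one_path_cycle_factor (H : rel V) (F : path_cycle) : bool :=
  [&& pc_path F != [::], sorted H (pc_path F),
      all (fun c => (1 < size c) && cycle H c) (pc_cycles F),
      uniq (pc_vertices F) & [forall x, x \in pc_vertices F]].

Definition pc_cost (w : V * V -> nat) (F : path_cycle) : nat :=
  \sum_(a <- pc_arcs F) w a.

End PathCycleFactors.

(** [m] is the maximum of [f] over the [x] such that [P x]; in particular the
    maximum is attained. *)
Definition is_maximum_of (T : Type) (P : T -> Prop) (f : T -> nat) (m : nat) :=
  (exists2 x, P x & f x = m) /\ (forall x, P x -> f x <= m).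

Definition is_sigma_hp_max (V : finType) (D : rel V) (m : nat) : Prop :=
  is_maximum_of (hamilton_oriented_path D) (sigma_plus D) m.

Definition is_c_pc_max (V : finType) (D : rel V) (m : nat) : Prop :=
  is_maximum_of (one_path_cycle_factor (hat D)) (pc_cost (hat_cost D)) m.

(** Running time is measured on Jones' WHILE programs (N. D. Jones,
    Computability and Complexity, MIT Press 1997): imperative programs whose
    variables hold binary trees, with a unit charge for each elementary
    operation. The only test is whether a tree is a leaf, so each operation
    takes constant time when trees are stored as shared cells. The problems
    decidable in polynomial time in this model are those decidable in
    polynomial time by Turing machines. *)

Inductive tree := Leaf | Node of tree & tree.

Definition hd (t : tree) := if t is Node l _ then l else Leaf.
Definition tl (t : tree) := if t is Node _ r then r else Leaf.
Definition is_node (t : tree) := if t is Node _ _ then true else false.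

Inductive expr :=
  | EVar of nat
  | ELeaf
  | ENode of expr & expr
  | EHd of expr
  | ETl of expr.

Inductive program :=
  | Skip
  | Assign of nat & expr
  | Seq of program & program
  | If of expr & program & program
  | While of expr & program.

Definition store := nat -> tree.

Definition update (s : store) (x : nat) (t : tree) : store :=
  fun y => if y == x then t else s y.

Fixpoint eval (s : store) (e : expr) : tree :=
  match e with
  | EVar x => s x
  | ELeaf => Leaf
  | ENode e1 e2 => Node (eval s e1) (eval s e2)
  | EHd e1 => hd (eval s e1)
  | ETl e1 => tl (eval s e1)
  end.

Fixpoint eval_time (e : expr) : nat :=
  match e with
  | EVar _ | ELeaf => 1
  | ENode e1 e2 => (eval_time e1 + eval_time e2).+1
  | EHd e1 | ETl e1 => (eval_time e1).+1
  end.

(** [exec c s s' t]: started in the store [s], the program [c] halts in the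
    store [s'] after [t] elementary steps. *)
Inductive exec : program -> store -> store -> nat -> Prop :=
  | exec_skip s : exec Skip s s 1
  | exec_assign s x e :
      exec (Assign x e) s (update s x (eval s e)) (eval_time e).+1
  | exec_seq c1 c2 s1 s2 s3 t1 t2 :
      exec c1 s1 s2 t1 -> exec c2 s2 s3 t2 ->
      exec (Seq c1 c2) s1 s3 (t1 + t2).+1
  | exec_if e c1 c2 s s' t :
      exec (if is_node (eval s e) then c1 else c2) s s' t ->
      exec (If e c1 c2) s s' (eval_time e + t).+1
  | exec_while_stop e c s :
      ~~ is_node (eval s e) -> exec (While e c) s s (eval_time e).+1
  | exec_while_step e c s1 s2 s3 t1 t2 :
      is_node (eval s1 e) -> exec c s1 s2 t1 -> exec (While e c) s2 s3 t2 ->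
      exec (While e c) s1 s3 (eval_time e + t1 + t2).+1.

(** Input and output both sit in variable 0; all other variables are initially
    [Leaf]. *)
Definition computes_in (c : program) (input output : tree) (t : nat) : Prop :=
  exists2 s, exec c (update (fun=> Leaf) 0 input) s t & s 0 = output.

(** Only numbers at most the number of vertices are ever encoded, so writing
    them in unary does not affect what is polynomial. *)
Definition encode_nat (n : nat) : tree := iter n (Node Leaf) Leaf.
Definition encode_bool (b : bool) : tree := if b then Node Leaf Leaf else Leaf.
Definition encode_seq (s : seq tree) : tree := foldr Node Leaf s.

(** A digraph is given to a program by its adjacency matrix, and a vertex is
    named by its rank in the enumeration indexing the rows and columns. *)
Definition encode_digraph (V : finType) (D : rel V) : tree :=
  encode_seq [seq encode_seq [seq encode_bool (D x y) | y <- enum V]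
             | x <- enum V].

Definition encode_path (V : finType) (s : seq V) : tree :=
  encode_seq [seq encode_nat (enum_rank x) | x <- s].

(* Main.v *)
Require Import Defs.
From mathcomp Require Import all_boot zify.

Set Implicit Arguments.
Unset Strict Implicit.
Unset Printing Implicit Defensive.

(** Adding a vertex [s] joined to everything in both directions turns
    1-path-cycle factors into fixed-point-free bijections along arcs, so a
    factor of maximum cost is an optimal assignment. Fix one, and let [D'] be
    [D] together with the zero-cost arcs it uses. It is again semicomplete
    multipartite, and a Hamilton path of [D'] uses at most as many zero-cost
    arcs as the factor does, hence costs at least as much. By Gutin's theorem
    such a path exists: the cycles of the factor can be absorbed into its path
    one at a time. A feasible factor exists because, with the vertices sorted by
    partite set, a cyclic shift by half the length is one.

    To absorb a cycle [C] into a path [P], assume that [C] cannot be inserted as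
    a whole. Let [a], [q] be consecutive on [P] with no arc from [C] to [a] but
    an arc [c q]; then the successor [v0] of [c] is in the partite set [A] of
    [a], and leaving out [v0] the insertion between [a] and [q] works. The
    vertex left out is now exchanged repeatedly with other vertices of [A]. If
    it never fits between two consecutive vertices, let [S] be the set of
    vertices that get left out. Write [x-], [x+] for the neighbours of [x] on
    [P] or [C]. Counting, for [v] in [S] on [C], the arcs from [u-] and [u+] to
    [v] over [u] in [S] after [q], and vice versa, gives the sum over pairs of
    [u- v] + [v- u] - [u+ v] - [v+ u] the lower bound of the number of such [v],
    although every summand is at most zero.

    The assignment is found by Bertsekas' auction, and a breadth-first search
    performs the exchanges, so everything is polynomial. *)

(** * Trees, encodings and polynomial time *)

Fixpoint tsize (t : tree) : nat :=
  if t is Node l r then (tsize l + tsize r).+1 else 1.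

(** A pair and a list cell are both a single node, and a number is encoded like a list of units.
    Hence [pt_cons], [pt_succn] and similar lemmas only reinterpret the same tree. *)
Class Enc (T : Type) := enc : T -> tree.

#[local] Instance enc_unit : Enc unit := fun=> Leaf.
#[local] Instance enc_bool : Enc bool := encode_bool.
#[local] Instance enc_nat : Enc nat := encode_nat.
#[local] Instance enc_pair T U `{Enc T} `{Enc U} : Enc (T * U) :=
  fun x => Node (enc x.1) (enc x.2).
#[local] Instance enc_list T `{Enc T} : Enc (seq T) :=
  fun s => encode_seq (map enc s).

Definition sz T `{Enc T} (x : T) : nat := tsize (enc x).

Lemma sz_gt0 T `{Enc T} (x : T) : 0 < sz x.
Proof. by rewrite /sz; case: (enc x). Qed.

Lemma sz_pair T U `{Enc T} `{Enc U} (x : T) (y : U) :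
  sz (x, y) = (sz x + sz y).+1.
Proof. by []. Qed.

Lemma sz_nil T `{Enc T} : sz (Nil T) = 1.
Proof. by []. Qed.

Lemma sz_cons T `{Enc T} (x : T) s : sz (x :: s) = (sz x + sz s).+1.
Proof. by []. Qed.

(** The base is at least 2, so a large exponent absorbs constants and sums and no coefficients are
    needed. *)
Definition poly_bounded T `{Enc T} (f : T -> nat) : Prop :=
  exists k, forall a, f a <= (sz a).+1 ^ k.

Section PolynomialBounds.
Context {T : Type} {eT : Enc T}.

Lemma pb_le (f g : T -> nat) : poly_bounded g -> (forall a, f a <= g a) -> poly_bounded f.
Proof. by move=> [k gk] fg; exists k => a; apply: leq_trans (fg a) _. Qed.

Lemma pb_const c : poly_bounded (fun _ : T => c).
Proof.
exists c => a; apply: leq_trans (ltnW (ltn_expl c (ltnSn 1))) _.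
by case: c => // c; rewrite leq_exp2r // ltnS sz_gt0.
Qed.

Lemma pb_sz : poly_bounded (fun a : T => sz a).
Proof. by exists 1 => a; rewrite expn1. Qed.

Lemma pb_add (f g : T -> nat) : poly_bounded f -> poly_bounded g -> poly_bounded (fun a => f a + g a).
Proof.
move=> [i fi] [j gj]; exists (maxn i j).+1 => a.
have s2 : 1 < (sz a).+1 by rewrite ltnS sz_gt0.
apply: (@leq_trans (2 * (sz a).+1 ^ maxn i j)); last by rewrite expnS leq_mul2r s2 orbT.
rewrite mul2n -addnn leq_add //.
  by apply: leq_trans (fi a) _; rewrite leq_exp2l // leq_maxl.
by apply: leq_trans (gj a) _; rewrite leq_exp2l // leq_maxr.
Qed.

Lemma pb_mul (f g : T -> nat) : poly_bounded f -> poly_bounded g -> poly_bounded (fun a => f a * g a).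
Proof. by move=> [i fi] [j gj]; exists (i + j) => a; rewrite expnD leq_mul. Qed.

Lemma pb_pow (f : T -> nat) k : poly_bounded f -> poly_bounded (fun a => f a ^ k).
Proof.
move=> [i fi]; exists (i * k) => a; rewrite expnM.
by case: k => // k; rewrite leq_exp2r.
Qed.

Lemma pb_comp U {eU : Enc U} (f : T -> U) (g : U -> nat) :
  poly_bounded (fun a => sz (f a)) -> poly_bounded g -> poly_bounded (fun a => g (f a)).
Proof.
move=> [i fi] [j gj]; exists (i.+1 * j) => a; apply: leq_trans (gj _) _.
rewrite expnM; case: j {gj} => // j; rewrite leq_exp2r //.
have s2 : 1 < (sz a).+1 by rewrite ltnS sz_gt0.
rewrite expnS; apply: leq_trans (_ : 2 * (sz a).+1 ^ i <= _); last by rewrite leq_mul2r s2 orbT.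
have := fi a; have : 0 < (sz a).+1 ^ i by rewrite expn_gt0.
lia.
Qed.

End PolynomialBounds.

(** * Variables left untouched by a program *)

Fixpoint vars_below m (e : expr) : bool :=
  match e with
  | EVar x => x < m
  | ELeaf => true
  | ENode e1 e2 => vars_below m e1 && vars_below m e2
  | EHd e | ETl e => vars_below m e
  end.

Fixpoint writes_below m (c : program) : bool :=
  match c with
  | Skip => true
  | Assign x _ => x < m
  | Seq c1 c2 | If _ c1 c2 => writes_below m c1 && writes_below m c2
  | While _ c => writes_below m c
  end.

Lemma writes_belowW m m' c : m <= m' -> writes_below m c -> writes_below m' c.
Proof.
move=> mm'; elim: c => //= [x _ | c1 I1 c2 I2 | _ c1 I1 c2 I2].
- by move=> xm; apply: leq_trans xm mm'.
- by case/andP=> /I1 -> /I2.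
- by case/andP=> /I1 -> /I2.
Qed.

(** A value stored in a variable from [m] on survives the run of a subprogram; this is how composite
    programs keep data. *)
Lemma exec_frame m c s s' t y :
  exec c s s' t -> writes_below m c -> m <= y -> s' y = s y.
Proof.
move=> H w my; elim: H w => //=.
- by move=> s0 x e xm; rewrite /update; case: eqP => // yx; lia.
- by move=> c1 c2 s1 s2 s3 t1 t2 _ I1 _ I2 /andP[w1 w2]; rewrite I2 ?I1.
- by move=> e c1 c2 s1 s2 t0; case: is_node => _ I1 /andP[w1 w2]; rewrite I1.
- by move=> e c0 s1 s2 s3 t1 t2 _ _ I1 _ I2 w; rewrite I2 ?I1.
Qed.

(** Quantifying over all initial stores makes programs composable: scratch
    variables need not be clean. *)
Definition polytime A B `{Enc A} `{Enc B} (f : A -> B) : Prop :=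
  poly_bounded (fun a => sz (f a)) /\
  exists c m tb, [/\ 0 < m, writes_below m c, poly_bounded tb &
    forall a s, s 0 = enc a -> exists s' t,
      [/\ exec c s s' t, s' 0 = enc (f a) & t <= tb a]].

(** Polynomial time depends on the result only through its tree, so the two result types may
    differ. *)
Lemma pt_recode A B B' `{Enc A} `{Enc B} `{Enc B'} (f : A -> B) (g : A -> B') :
  (forall a, enc (g a) = enc (f a)) -> polytime f -> polytime g.
Proof.
move=> fg [szf [c [m [tb [m0 w tbP cP]]]]]; split.
  by apply: pb_le szf _ => a; rewrite /sz fg.
by exists c, m, tb; split=> // a s /cP[s' [t [e e0 tt]]]; exists s', t; rewrite fg.
Qed.

Lemma pt_ext A B `{Enc A} `{Enc B} (f g : A -> B) : f =1 g -> polytime f -> polytime g.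
Proof. by move=> fg; apply: pt_recode => a; rewrite fg. Qed.

Lemma pt_expr A B `{Enc A} `{Enc B} (f : A -> B) e :
  (forall a s, s 0 = enc a -> eval s e = enc (f a)) ->
  poly_bounded (fun a => sz (f a)) -> polytime f.
Proof.
move=> ef szf; split=> //.
exists (Assign 0 e), 1, (fun=> (eval_time e).+1); split=> //; first exact: pb_const.
by move=> a s s0; do 2!eexists; split; [exact: exec_assign | rewrite /update /= (ef a) | ].
Qed.

(** * Closure under composition, branching and bounded loops *)

Section Closure.
Context {A : Type} {eA : Enc A}.

Lemma pt_id : polytime (fun a : A => a).
Proof. by apply: (@pt_expr _ _ _ _ _ (EVar 0)) => //; apply: pb_sz. Qed.

Lemma pt_const B {eB : Enc B} (b : B) : polytime (fun _ : A => b).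
Proof.
pose fix quote t := if t is Node l r then ENode (quote l) (quote r) else ELeaf.
apply: (@pt_expr _ _ _ _ _ (quote (enc b))); last exact: pb_const.
by move=> a s _; elim: (enc b) => //= l -> r ->.
Qed.

Lemma pt_comp B C {eB : Enc B} {eC : Enc C} (f : A -> B) (g : B -> C) :
  polytime f -> polytime g -> polytime (fun a => g (f a)).
Proof.
move=> [szf [c [m [tb [m0 w tbP cP]]]]] [szg [c' [m' [tb' [m0' w' tbP' cP']]]]].
split; first exact: (pb_comp szf szg).
exists (Seq c c'), (maxn m m'), (fun a => (tb a + tb' (f a)) + 1); split.
- by rewrite leq_max m0.
- by rewrite /= !(writes_belowW _ w, writes_belowW _ w') ?leq_maxl ?leq_maxr.
- apply: pb_add; last exact: pb_const.
  by apply: pb_add => //; apply: pb_comp szf tbP'.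
move=> a s /cP[s1 [t1 [e1 /cP'[s2 [t2 [e2 s2E t2b]]] t1b]]].
exists s2, (t1 + t2).+1; split=> //; first exact: exec_seq e1 e2.
by rewrite addn1 ltnS leq_add.
Qed.

Lemma pt_pair B C {eB : Enc B} {eC : Enc C} (f : A -> B) (g : A -> C) :
  polytime f -> polytime g -> polytime (fun a => (f a, g a)).
Proof.
move=> [szf [c [m [tb [m0 w tbP cP]]]]] [szg [c' [m' [tb' [m0' w' tbP' cP']]]]].
split.
  apply: (pb_le (pb_add (pb_add szf szg) (pb_const 1))) => a.
  by rewrite sz_pair addn1.
(* Variables from [M] on are out of reach of both subprograms: [M] keeps the input and [M.+1] the
   first result. *)
pose M := maxn m m'.
have mM : m <= M by apply: leq_maxl.
have mM' : m' <= M by apply: leq_maxr.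
exists (Seq (Assign M (EVar 0)) (Seq c (Seq (Assign M.+1 (EVar 0))
  (Seq (Assign 0 (EVar M)) (Seq c' (Assign 0 (ENode (EVar M.+1) (EVar 0)))))))),
  M.+2, (fun a => (tb a + tb' a) + 20); split=> //=.
- rewrite !(writes_belowW _ w, writes_belowW _ w'); lia.
- by apply: pb_add; [exact: pb_add | exact: pb_const].
move=> a s s0.
set s1 := update s M (s 0).
have /cP[s2 [t2 [e2 s2E t2b]]] : s1 0 = enc a by rewrite /s1 /update; case: eqP => // _; case: eqP.
set s3 := update s2 M.+1 (s2 0).
set s4 := update s3 0 (s3 M).
have s3M : s3 M = enc a.
  rewrite /s3 /update; case: eqP => [|_]; first by lia.
  by rewrite (exec_frame e2 w) // /s1 /update eqxx.
have /cP'[s5 [t5 [e5 s5E t5b]]] : s4 0 = enc a by rewrite /s4 /update /=.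
have s5M : s5 M.+1 = enc (f a).
  rewrite (exec_frame e5 w') ?leqW // /s4 /update /=.
  by rewrite /s3 /update eqxx.
do 2!eexists; split.
- apply: exec_seq; first exact: exec_assign.
  apply: exec_seq; first exact: e2.
  apply: exec_seq; first exact: exec_assign.
  apply: exec_seq; first exact: exec_assign.
  apply: exec_seq; first exact: e5.
  exact: exec_assign.
- by rewrite /update /= s5M s5E.
- by rewrite /=; lia.
Qed.

Lemma pt_fst B C {eB : Enc B} {eC : Enc C} (f : A -> B * C) :
  polytime f -> polytime (fun a => (f a).1).
Proof.
move=> pf; apply: (@pt_comp _ _ _ _ f fst) => //.
apply: (@pt_expr _ _ _ _ _ (EHd (EVar 0))) => [[b c] s /= -> //|].
by apply: (pb_le pb_sz) => -[b c]; rewrite sz_pair /=; lia.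
Qed.

Lemma pt_snd B C {eB : Enc B} {eC : Enc C} (f : A -> B * C) :
  polytime f -> polytime (fun a => (f a).2).
Proof.
move=> pf; apply: (@pt_comp _ _ _ _ f snd) => //.
apply: (@pt_expr _ _ _ _ _ (ETl (EVar 0))) => [[b c] s /= -> //|].
by apply: (pb_le pb_sz) => -[b c]; rewrite sz_pair /=; lia.
Qed.

Lemma pt_cons B {eB : Enc B} (f : A -> B) g :
  polytime f -> polytime g -> polytime (fun a => f a :: g a).
Proof. by move=> pf pg; apply: pt_recode (pt_pair pf pg). Qed.

Lemma pt_if B {eB : Enc B} (b : A -> bool) (f g : A -> B) :
  polytime b -> polytime f -> polytime g -> polytime (fun a => if b a then f a else g a).
Proof.
move=> [_ [c0 [m0 [tb0 [m00 w0 tbP0 cP0]]]]].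
move=> [szf [c [m [tb [_ w tbP cP]]]]] [szg [c' [m' [tb' [_ w' tbP' cP']]]]].
split.
  by apply: (pb_le (pb_add szf szg)) => a; case: (b a); rewrite ?leq_addl ?leq_addr.
pose M := maxn m0 (maxn m m').
have mM0 : m0 <= M by apply: leq_maxl.
have mM : m <= M by rewrite /M !leq_max leqnn orbT.
have mM' : m' <= M by rewrite /M !leq_max leqnn !orbT.
exists (Seq (Assign M (EVar 0)) (Seq c0 (If (EVar 0)
  (Seq (Assign 0 (EVar M)) c) (Seq (Assign 0 (EVar M)) c')))),
  M.+1, (fun a => (tb0 a + (tb a + tb' a)) + 20); split=> //=.
- rewrite !(writes_belowW _ w, writes_belowW _ w', writes_belowW _ w0); lia.
- by apply: pb_add; [do 2!apply: pb_add => // | exact: pb_const].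
move=> a s s0.
set s1 := update s M (s 0).
have /cP0[s2 [t2 [e2 s2E t2b]]] : s1 0 = enc a by rewrite /s1 /update; case: eqP => // _; case: eqP.
set s4 := update s2 0 (s2 M).
have s4E : s4 0 = enc a.
  by rewrite /s4 /update /= (exec_frame e2 w0) // /s1 /update eqxx.
have ifE : is_node (eval s2 (EVar 0)) = b a by rewrite /= s2E; case: (b a).
move: ifE; case: (b a) => ifE.
- have [s5 [t5 [e5 s5E t5b]]] := cP _ _ s4E.
  exists s5; eexists; split; [ | exact: s5E | ].
    apply: exec_seq; first exact: exec_assign.
    apply: exec_seq; first exact: e2.
    apply: exec_if; rewrite ifE.
    by apply: exec_seq; [exact: exec_assign | exact: e5].
  by rewrite /=; lia.
- have [s5 [t5 [e5 s5E t5b]]] := cP' _ _ s4E.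
  exists s5; eexists; split; [ | exact: s5E | ].
    apply: exec_seq; first exact: exec_assign.
    apply: exec_seq; first exact: e2.
    apply: exec_if; rewrite ifE.
    by apply: exec_seq; [exact: exec_assign | exact: e5].
  by rewrite /=; lia.
Qed.

(** The tree of a list is a node exactly when the list is nonempty, so the test of [If] performs the
    case analysis. *)
Lemma pt_case B X {eB : Enc B} {eX : Enc X} (l : A -> seq X) (f : A -> B)
    (g : A -> X -> seq X -> B) :
  polytime l -> polytime f -> polytime (fun p : A * X * seq X => g p.1.1 p.1.2 p.2) ->
  polytime (fun a => if l a is x :: t then g a x t else f a).
Proof.
move=> [szl [c0 [m0 [tb0 [m00 w0 tbP0 cP0]]]]].
move=> [szf [c [m [tb [_ w tbP cP]]]]] [szg [c' [m' [tb' [_ w' tbP' cP']]]]].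
pose arg a : option (A * X * seq X) := if l a is x :: t then Some (a, x, t) else None.
have pbo (h : A * X * seq X -> nat) : poly_bounded h -> poly_bounded (fun a => if arg a is Some p then h p else 0).
  move=> [k hk]; apply: (@pb_le _ _ _ (fun a => (sz a + sz (l a) + 3) ^ k)).
    by apply: pb_pow; do !apply: pb_add; try exact: pb_sz; try exact: pb_const.
  move=> a; rewrite /arg; case la: (l a) => [|x t] //=; apply: leq_trans (hk _) _.
  by case: k {hk} => // k; rewrite leq_exp2r // !sz_pair sz_cons; lia.
split.
  apply: (pb_le (pb_add szf (pbo _ szg))) => a; rewrite /arg.
  by case: (l a) => [|x t] /=; rewrite ?leq_addl ?leq_addr.
pose M := maxn m0 (maxn m m').
have mM0 : m0 <= M by apply: leq_maxl.
have mM : m <= M by rewrite /M !leq_max leqnn orbT.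
have mM' : m' <= M by rewrite /M !leq_max leqnn !orbT.
exists (Seq (Assign M (EVar 0)) (Seq c0 (If (EVar 0)
  (Seq (Assign 0 (ENode (ENode (EVar M) (EHd (EVar 0))) (ETl (EVar 0)))) c')
  (Seq (Assign 0 (EVar M)) c)))),
  M.+1, (fun a => (tb0 a + (tb a + if arg a is Some p then tb' p else 0)) + 40); split=> //=.
- rewrite !(writes_belowW _ w, writes_belowW _ w', writes_belowW _ w0); lia.
- by apply: pb_add; [do 2!apply: pb_add => //; exact: pbo | exact: pb_const].
move=> a s s0.
set s1 := update s M (s 0).
have /cP0[s2 [t2 [e2 s2E t2b]]] : s1 0 = enc a by rewrite /s1 /update; case: eqP => // _; case: eqP.
have s2M : s2 M = enc a by rewrite (exec_frame e2 w0) // /s1 /update eqxx.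
rewrite /arg; move: s2E; case: (l a) => [|x t] s2E.
- set s4 := update s2 0 (s2 M).
  have s4E : s4 0 = enc a by [].
  have [s5 [t5 [e5 s5E t5b]]] := cP _ _ s4E.
  exists s5; eexists; split; [ | exact: s5E | ].
    apply: exec_seq; first exact: exec_assign.
    apply: exec_seq; first exact: e2.
    apply: exec_if; rewrite /= s2E /=.
    by apply: exec_seq; [exact: exec_assign | exact: e5].
  by rewrite /=; lia.
- set s4 := update s2 0 (Node (Node (s2 M) (hd (s2 0))) (tl (s2 0))).
  have s4E : s4 0 = enc (a, x, t) by rewrite /s4 /update /= s2M s2E.
  have [s5 [t5 [e5 s5E t5b]]] := cP' _ _ s4E.
  exists s5; eexists; split; [ | exact: s5E | ].
    apply: exec_seq; first exact: exec_assign.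
    apply: exec_seq; first exact: e2.
    apply: exec_if; rewrite /= s2E /=.
    by apply: exec_seq; [exact: exec_assign | exact: e5].
  by rewrite /=; lia.
Qed.

Lemma sz_drop X {eX : Enc X} i (l : seq X) : sz (drop i l) <= sz l.
Proof.
elim: l i => [|x l IH] [|i] //=; rewrite sz_cons; have := IH i; lia.
Qed.

Lemma size_lt_sz X {eX : Enc X} (l : seq X) : size l < sz l.
Proof. by elim: l => //= y l IH; rewrite sz_cons; have := sz_gt0 y; lia. Qed.

(** A polynomial bound on a single step does not limit the whole loop, since the accumulator might
    be squared in size in each round. Hence the separate bound on all intermediate accumulators. *)
Lemma pt_foldl S X {eS : Enc S} {eX : Enc X} (step : A -> S -> X -> S)
    (init : A -> S) (l : A -> seq X) :
  polytime init -> polytime l -> polytime (fun p : A * S * X => step p.1.1 p.1.2 p.2) ->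
  (exists2 b : A -> nat, poly_bounded b & forall a i,
     sz (foldl (step a) (init a) (take i (l a))) <= b a) ->
  polytime (fun a => foldl (step a) (init a) (l a)).
Proof.
move=> [szi [c0 [m0 [tb0 [m00 w0 tbP0 cP0]]]]].
move=> [szl [c [m [tb [_ w tbP cP]]]]] [_ [c' [m' [tb' [_ w' [k tbP'] cP']]]]] [b bP bb].
split.
  by apply: (pb_le bP) => a; rewrite -{1}(take_size (l a)).
pose M := maxn m0 (maxn m m').
have mM0 : m0 <= M by apply: leq_maxl.
have mM : m <= M by rewrite /M !leq_max leqnn orbT.
have mM' : m' <= M by rewrite /M !leq_max leqnn !orbT.
(* [M] holds the input, [M.+1] the accumulator and [M.+2] the rest of the list. *)
pose body := Seq (Assign 0 (ENode (ENode (EVar M) (EVar M.+1)) (EHd (EVar M.+2))))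
  (Seq c' (Seq (Assign M.+1 (EVar 0)) (Assign M.+2 (ETl (EVar M.+2))))).
(* Cost of one round: the time polynomial of [step] at a bound on the size of its argument, plus 30
   for bookkeeping. *)
pose B a := (@sz A eA a + b a + @sz (seq X) (@enc_list X eX) (l a) + 3) ^ k + 30.
exists (Seq (Assign M (EVar 0)) (Seq c0 (Seq (Assign M.+1 (EVar 0))
  (Seq (Assign 0 (EVar M)) (Seq c (Seq (Assign M.+2 (EVar 0))
  (Seq (While (EVar M.+2) body) (Assign 0 (EVar M.+1))))))))),
  M.+3, (fun a => (tb0 a + (tb a + sz (l a) * B a)) + 40); split=> //=.
- rewrite !(writes_belowW _ w, writes_belowW _ w', writes_belowW _ w0); lia.
- apply: pb_add; last exact: pb_const.
  do 2!apply: pb_add => //; apply: pb_mul => //; apply: pb_add; last exact: pb_const.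
  by apply: pb_pow; do !apply: pb_add => //; [exact: pb_sz | exact: pb_const].
move=> a s s0.
set s1 := update s M (s 0).
have /cP0[s2 [t2 [e2 s2E t2b]]] : s1 0 = enc a by rewrite /s1 /update; case: eqP => // _; case: eqP.
have s2M : s2 M = enc a by rewrite (exec_frame e2 w0) // /s1 /update eqxx.
set s3 := update s2 M.+1 (s2 0).
set s4 := update s3 0 (s3 M).
have s4E : s4 0 = enc a by rewrite /s4 /s3 /update /=; case: eqP => // ?; lia.
have /cP[s5 [t5 [e5 s5E t5b]]] := s4E.
set s6 := update s5 M.+2 (s5 0).
have s6M : s6 M = enc a.
  rewrite /s6 /update; case: eqP => [|_]; first by lia.
  rewrite (exec_frame e5 w) // /s4 /update; case: eqP => [_|_].
    by rewrite /s3 /update; case: eqP => // ?; lia.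
  by rewrite /s3 /update; case: eqP => // ?; lia.
have s6M1 : s6 M.+1 = enc (init a).
  rewrite /s6 /update; case: eqP => [|_]; first by lia.
  rewrite (exec_frame e5 w) ?leqW // /s4 /update /= /s3 /update eqxx //.
have s6M2 : s6 M.+2 = enc (l a) by rewrite /s6 /update eqxx.
have loop : forall r i (s : store), s M = enc a ->
    s M.+1 = enc (foldl (step a) (init a) (take i (l a))) ->
    s M.+2 = enc r -> r = drop i (l a) ->
    exists s' t, [/\ exec (While (EVar M.+2) body) s s' t,
       s' M.+1 = enc (foldl (step a) (init a) (l a)) & t <= size r * B a + 2].
  elim=> [|x r IH] i st sM sM1 sM2 rE.
    exists st; eexists; split; first by apply: exec_while_stop; rewrite /= sM2.
      by rewrite sM1 take_oversize // -subn_eq0 -size_drop -rE.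
    by [].
  set f := foldl (step a) (init a) (take i (l a)) in sM1.
  set u1 := update st 0 (Node (Node (st M) (st M.+1)) (hd (st M.+2))).
  have u1E : u1 0 = enc (a, f, x) by rewrite /u1 /update /= sM sM1 sM2.
  have [u2 [t6 [e6 u2E t6b]]] := cP' _ _ u1E.
  set u3 := update u2 M.+1 (u2 0).
  set u4 := update u3 M.+2 (tl (u3 M.+2)).
  have il : i < size (l a) by rewrite ltnNge -subn_eq0 -size_drop -rE.
  have [] := IH i.+1 u4.
  - rewrite /u4 /u3 /update; do 2!(case: eqP => [|_]; first by lia).
    rewrite (exec_frame e6 w') // /u1 /update; case: eqP => // M0.
    by move: m00 mM0; lia.
  - rewrite /u4 /u3 /update; case: eqP => [|_]; first by lia.
    rewrite eqxx u2E; congr enc.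
    rewrite (take_nth x) // -cats1 foldl_cat /=; congr (step a _ _).
    by rewrite -[i]addn0 -nth_drop -rE.
  - rewrite /u4 /update eqxx /u3 /update; case: eqP => [|_]; first by lia.
    by rewrite (exec_frame e6 w') ?leqW // /u1 /update /= sM2.
  - by rewrite -addn1 addnC -drop_drop -rE /= drop0.
  move=> u5 [t7 [e7 u5E t7b]].
  exists u5; eexists; split; [ | exact: u5E | ].
    apply: exec_while_step; [by rewrite /= sM2 | | exact: e7].
    apply: exec_seq; first exact: exec_assign.
    apply: exec_seq; first exact: e6.
    apply: exec_seq; first exact: exec_assign.
    exact: exec_assign.
  have t6B : t6 + 30 <= B a.
    rewrite leq_add2r; apply: leq_trans t6b (leq_trans (tbP' _) _).
    case: (k) => // k'; rewrite leq_exp2r // !sz_pair.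
    have : sz f <= b a by apply: bb.
    by have := @sz_drop X eX i (l a); rewrite -rE sz_cons; lia.
  by rewrite /= mulSn; lia.
have [s7 [t7 [e7 s7E t7b]]] := loop (l a) 0 s6 s6M (etrans s6M1 (congr1 _ (esym (congr1 _ (take0 _))))) s6M2 (esym (drop0 _)).
exists (update s7 0 (s7 M.+1)); eexists; split.
- apply: exec_seq; first exact: exec_assign.
  apply: exec_seq; first exact: e2.
  apply: exec_seq; first exact: exec_assign.
  apply: exec_seq; first exact: exec_assign.
  apply: exec_seq; first exact: e5.
  apply: exec_seq; first exact: exec_assign.
  apply: exec_seq; first exact: e7.
  exact: exec_assign.
- by rewrite /update.
- have : size (l a) * B a <= sz (l a) * B a by rewrite leq_mul2r (ltnW (size_lt_sz _)) orbT.
  by rewrite /=; lia.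
Qed.

Lemma pt_negb (b : A -> bool) : polytime b -> polytime (fun a => ~~ b a).
Proof. by move=> pb_; apply: pt_if pb_ (pt_const _) (pt_const _). Qed.

Lemma pt_andb (b c : A -> bool) :
  polytime b -> polytime c -> polytime (fun a => b a && c a).
Proof. by move=> pb_ pc; apply: pt_if pb_ pc (pt_const _). Qed.

Lemma pt_orb (b c : A -> bool) :
  polytime b -> polytime c -> polytime (fun a => b a || c a).
Proof. by move=> pb_ pc; apply: pt_if pb_ (pt_const _) pc. Qed.

Lemma sz_cat X {eX : Enc X} (s t : seq X) : (sz (s ++ t)).+1 = sz s + sz t.
Proof. by elim: s => //= x s IH; rewrite !sz_cons; lia. Qed.

Lemma sz_rev X {eX : Enc X} (s : seq X) : sz (rev s) = sz s.
Proof.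
elim: s => //= x s IH; rewrite rev_cons -cats1; apply: succn_inj.
by rewrite sz_cat !sz_cons IH /sz /=; lia.
Qed.

Lemma sz_take X {eX : Enc X} i (l : seq X) : sz (take i l) <= sz l.
Proof. by elim: l i => [|x l IH] [|i] //=; rewrite !sz_cons; have := IH i; lia. Qed.

Lemma sz_filter X {eX : Enc X} p (l : seq X) : sz (filter p l) <= sz l.
Proof. by elim: l => //= x l IH; case: (p x); rewrite !sz_cons; lia. Qed.

Lemma sz_flatten X {eX : Enc X} (l : seq (seq X)) : sz (flatten l) <= sz l.
Proof. by elim: l => //= x l IH; rewrite sz_cons; have := @sz_cat X eX x (flatten l); lia. Qed.

Lemma sz_nat (n : nat) : sz n = n.*2.+1.
Proof. by rewrite /sz /enc /enc_nat; elim: n => //= n ->; lia. Qed.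

Lemma sz_seq_le X {eX : Enc X} (l : seq X) b :
  all (fun x => sz x <= b) l -> sz l <= (size l * b.+1).+1.
Proof. by elim: l => //= x l IH /andP[xb /IH]; rewrite sz_cons mulSn; lia. Qed.

Lemma sz_bool (b : bool) : sz b <= 3.
Proof. by case: b. Qed.

End Closure.

(** Decomposes a goal by the head symbol of the function body; a pattern such as [@?f] abstracts
    each subterm over the argument. *)
Ltac pt_step := cbv beta; first [ assumption | lazymatch goal with
  | |- polytime (fun a => a) => exact: pt_id
  | |- polytime fst => exact: (pt_fst pt_id)
  | |- polytime snd => exact: (pt_snd pt_id)
  | |- polytime (fun _ => ?b) => exact: pt_const
  | |- polytime (fun a => (@?f a).1) => apply: (pt_fst (f := f))
  | |- polytime (fun a => (@?f a).2) => apply: (pt_snd (f := f))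
  | |- polytime (fun a => (@?f a, @?g a)) => apply: (pt_pair (f := f) (g := g))
  | |- polytime (fun a => @?f a :: @?g a) => apply: (pt_cons (f := f) (g := g))
  end ].
Ltac pt_auto := repeat pt_step.

(** * List operations and unary arithmetic *)

Lemma pt_rev A {eA : Enc A} X {eX : Enc X} (l : A -> seq X) :
  polytime l -> polytime (fun a => rev (l a)).
Proof.
have foldlE (s : seq X) : foldl (fun s x => x :: s) [::] s = rev s.
  rewrite /rev; elim: s [::] => //= x s IH t; exact: IH.
move=> pl; apply: pt_ext (fun a => foldlE (l a)) _.
apply: (pt_foldl (step := fun _ s x => x :: s) (pt_const _) pl); first by pt_auto.
by case: pl => szl _; exists (fun a => sz (l a)) => // a i; rewrite foldlE sz_rev sz_take.
Qed.

Lemma pt_cat A {eA : Enc A} X {eX : Enc X} (s t : A -> seq X) :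
  polytime s -> polytime t -> polytime (fun a => s a ++ t a).
Proof.
move=> ps qt.
have foldlE (u v : seq X) : foldl (fun s x => x :: s) v u = rev u ++ v.
  elim: u v => //= x u IH v; rewrite IH rev_cons -cats1 -catA //.
apply: (@pt_ext _ _ _ _ (fun a => foldl (fun s x => x :: s) (t a) (rev (s a)))).
  by move=> a; rewrite foldlE revK.
apply: (pt_foldl (step := fun _ s x => x :: s) qt (pt_rev ps)); first by pt_auto.
case: ps qt => szs _ [szt _]; exists (fun a => sz (s a) + sz (t a)); first exact: pb_add.
move=> a i; rewrite foldlE; apply: leq_trans (leqnSn _) _.
by rewrite sz_cat leq_add2r sz_rev -[leqRHS]sz_rev sz_take.
Qed.

(* The fuel [n] is unary, so it is itself a list to fold over. *)
Lemma pt_iter A {eA : Enc A} S {eS : Enc S} (n : A -> nat) (step : A -> S -> S) (init : A -> S) :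
  polytime n -> polytime init -> polytime (fun p : A * S => step p.1 p.2) ->
  (exists2 b : A -> nat, poly_bounded b & forall a i, i <= n a ->
     sz (iter i (step a) (init a)) <= b a) ->
  polytime (fun a => iter (n a) (step a) (init a)).
Proof.
move=> pn pinit pstep [b bP bb].
have foldlE (f : S -> S) x (s : seq unit) : foldl (fun s _ => f s) x s = iter (size s) f x.
  by elim: s x => //= _ s IH x; rewrite IH -iterSr.
apply: (@pt_ext _ _ _ _ (fun a => foldl (fun s (_ : unit) => step a s) (init a) (nseq (n a) tt))).
  by move=> a; rewrite foldlE size_nseq.
apply: (pt_foldl (step := fun a s (_ : unit) => step a s) pinit).
- apply: pt_recode pn => a; rewrite /enc /enc_list /enc_nat /encode_nat.
  by elim: (n a) => //= k ->.
- apply: (pt_comp (f := fun p : A * S * unit => (p.1.1, p.1.2)) _ pstep).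
  by pt_auto.
exists b => // a i; rewrite foldlE; apply: bb.
by rewrite size_take_min size_nseq geq_minr.
Qed.

Lemma pt_succn A {eA : Enc A} (n : A -> nat) : polytime n -> polytime (fun a => (n a).+1).
Proof. by move=> pn; apply: pt_recode (pt_pair (pt_const tt) pn). Qed.

Lemma pt_addn A {eA : Enc A} (m n : A -> nat) :
  polytime m -> polytime n -> polytime (fun a => m a + n a).
Proof.
move=> pm pn; have iterE a k : iter k succn (n a) = k + n a
  by elim: k => //= k ->; rewrite ?mulSn ?addSn.
apply: pt_ext (fun a => iterE a (m a)) _.
apply: (pt_iter (step := fun _ => succn) pm pn); first by cbv beta; apply: pt_succn; pt_auto.
case: pm pn => szm _ [szn _]; exists (fun a => sz (m a) + sz (n a)); first exact: pb_add.
by move=> a i ia; rewrite iterE !sz_nat; lia.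
Qed.

Lemma pt_muln A {eA : Enc A} (m n : A -> nat) :
  polytime m -> polytime n -> polytime (fun a => m a * n a).
Proof.
move=> pm pn; have iterE a k : iter k (addn (n a)) 0 = k * n a
  by elim: k => //= k ->; rewrite ?mulSn ?addSn.
apply: pt_ext (fun a => iterE a (m a)) _.
apply: (pt_iter (step := fun a => addn (n a)) pm (pt_const 0)).
  by apply: pt_addn; pt_auto; apply: (pt_comp (f := fst) _ pn); pt_auto.
case: pm pn => szm _ [szn _]; exists (fun a => sz (m a) * sz (n a)); first exact: pb_mul.
by move=> a i ia; rewrite iterE !sz_nat; nia.
Qed.

Lemma pt_behead A {eA : Enc A} X {eX : Enc X} (l : A -> seq X) :
  polytime l -> polytime (fun a => behead (l a)).
Proof.
move=> pl; apply: (@pt_ext _ _ _ _ (fun a => if l a is x :: t then t else [::])) => [a|].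
  by case: (l a).
by apply: (pt_case (g := fun _ _ t => t) pl (pt_const _)); pt_auto.
Qed.

Lemma pt_head A {eA : Enc A} X {eX : Enc X} (x0 : A -> X) (l : A -> seq X) :
  polytime x0 -> polytime l -> polytime (fun a => head (x0 a) (l a)).
Proof.
move=> px pl; apply: (@pt_ext _ _ _ _ (fun a => if l a is x :: t then x else x0 a)) => [a|].
  by case: (l a).
by apply: (pt_case (g := fun _ x _ => x) pl px); pt_auto.
Qed.

Lemma pt_predn A {eA : Enc A} (n : A -> nat) : polytime n -> polytime (fun a => (n a).-1).
Proof.
move=> pn; apply: pt_recode (pt_behead (l := fun a => nseq (n a) tt) _).
  move=> a; rewrite /enc /enc_list /enc_nat /encode_nat.
  by case: (n a) => //= k; elim: k => //= k ->.
apply: pt_recode pn => a; rewrite /enc /enc_list /enc_nat /encode_nat.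
by elim: (n a) => //= k ->.
Qed.

Lemma pt_subn A {eA : Enc A} (m n : A -> nat) :
  polytime m -> polytime n -> polytime (fun a => m a - n a).
Proof.
move=> pm pn; have iterE a k : iter k predn (m a) = m a - k
  by elim: k => [|k IH]; rewrite ?subn0 //= IH subnS.
apply: pt_ext (fun a => iterE a (n a)) _.
apply: (pt_iter (step := fun _ => predn) pn pm); first by cbv beta; apply: pt_predn; pt_auto.
case: pm => szm _; exists (fun a => sz (m a)) => // a i _.
by rewrite iterE !sz_nat; lia.
Qed.

Lemma pt_eq0 A {eA : Enc A} (n : A -> nat) : polytime n -> polytime (fun a => n a == 0).
Proof.
move=> pn.
apply: (@pt_ext _ _ _ _ (fun a => if nseq (n a) tt is x :: t then false else true)) => [a|].
  by case: (n a).
apply: (pt_case (g := fun _ _ _ => false) _ (pt_const _)); last by pt_auto.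
apply: pt_recode pn => a; rewrite /enc /enc_list /enc_nat /encode_nat.
by elim: (n a) => //= k ->.
Qed.

Lemma pt_leq A {eA : Enc A} (m n : A -> nat) :
  polytime m -> polytime n -> polytime (fun a => m a <= n a).
Proof. by move=> pm pn; apply: pt_eq0; apply: pt_subn. Qed.

Lemma pt_eqn A {eA : Enc A} (m n : A -> nat) :
  polytime m -> polytime n -> polytime (fun a => m a == n a).
Proof.
move=> pm pn; apply: (@pt_ext _ _ _ _ (fun a => (m a <= n a) && (n a <= m a))).
  by move=> a; rewrite eqn_leq.
by apply: pt_andb; apply: pt_leq.
Qed.

Lemma pt_size A {eA : Enc A} X {eX : Enc X} (l : A -> seq X) :
  polytime l -> polytime (fun a => size (l a)).
Proof.
move=> pl; have foldlE (s : seq X) k : foldl (fun n _ => n.+1) k s = k + size s.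
  by elim: s k => [|x s IH] k /=; rewrite ?addn0 // IH addSnnS.
apply: pt_ext (fun a => foldlE (l a) 0) _.
apply: (pt_foldl (step := fun _ n _ => n.+1) (pt_const 0) pl).
  by cbv beta; apply: pt_succn; pt_auto.
case: pl => szl _; exists (fun a => sz (l a) + sz (l a)); first exact: pb_add.
move=> a i; rewrite foldlE sz_nat size_take_min.
by have := @size_lt_sz X eX (l a); have := geq_minr i (size (l a)); lia.
Qed.

Lemma pt_drop A {eA : Enc A} X {eX : Enc X} (i : A -> nat) (l : A -> seq X) :
  polytime i -> polytime l -> polytime (fun a => drop (i a) (l a)).
Proof.
move=> pi pl; have iterE a k : iter k behead (l a) = drop k (l a).
  elim: k => [|k IH] /=; first by rewrite drop0.
  by rewrite IH -drop1 drop_drop.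
apply: pt_ext (fun a => iterE a (i a)) _.
apply: (pt_iter (step := fun _ => behead) pi pl); first by cbv beta; apply: pt_behead; pt_auto.
by case: pl => szl _; exists (fun a => sz (l a)) => // a k _; rewrite iterE sz_drop.
Qed.

Lemma pt_take A {eA : Enc A} X {eX : Enc X} (i : A -> nat) (l : A -> seq X) :
  polytime i -> polytime l -> polytime (fun a => take (i a) (l a)).
Proof.
move=> pi pl.
apply: (@pt_ext _ _ _ _ (fun a => rev (drop (size (l a) - i a) (rev (l a))))) => [a|].
  by rewrite -(size_rev (l a)) -take_rev revK.
by apply/pt_rev/pt_drop; [apply: pt_subn => //; apply: pt_size | apply: pt_rev].
Qed.

Lemma pt_nth A {eA : Enc A} X {eX : Enc X} (x0 : A -> X) (l : A -> seq X) (i : A -> nat) :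
  polytime x0 -> polytime l -> polytime i -> polytime (fun a => nth (x0 a) (l a) (i a)).
Proof.
move=> px pl pi; apply: (@pt_ext _ _ _ _ (fun a => head (x0 a) (drop (i a) (l a)))) => [a|].
  by rewrite -nth0 nth_drop addn0.
by apply: pt_head => //; apply: pt_drop.
Qed.

(** Makes a bound uniform over the elements of a list, whose encodings are no larger than that of
    the list. *)
Lemma pb_bounded_arg A {eA : Enc A} X {eX : Enc X} (l : A -> seq X) (h : A * X -> nat) :
  poly_bounded (fun a => sz (l a)) -> poly_bounded h ->
  exists2 b : A -> nat, poly_bounded b & forall a x, sz x <= sz (l a) -> h (a, x) <= b a.
Proof.
move=> szl [k hk]; exists (fun a => (sz a + sz (l a) + 2) ^ k).
  by apply: pb_pow; do !apply: pb_add => //; [exact: pb_sz | exact: pb_const].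
move=> a x xl; apply: leq_trans (hk _) _.
by case: (k) => // k'; rewrite leq_exp2r // sz_pair; lia.
Qed.

Lemma pt_map A {eA : Enc A} X Y {eX : Enc X} {eY : Enc Y} (f : A -> X -> Y) (l : A -> seq X) :
  polytime l -> polytime (fun p : A * X => f p.1 p.2) -> polytime (fun a => map (f a) (l a)).
Proof.
move=> pl pf.
have foldlE g (s : seq X) : foldl (fun s x => g x :: s) [::] s = rev (map g s) :> seq Y.
  rewrite -[RHS]cats0; elim: s [::] => //= x s IH t.
  by rewrite IH rev_cons -cats1 -catA.
apply: (@pt_ext _ _ _ _ (fun a => rev (foldl (fun s x => f a x :: s) [::] (l a)))) => [a|].
  by rewrite foldlE revK.
apply/pt_rev/(pt_foldl (step := fun a s x => f a x :: s)) => //; first exact: pt_const.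
  apply: pt_cons; last by pt_auto.
  by apply: (pt_comp (f := fun p : A * seq Y * X => (p.1.1, p.2)) _ pf); pt_auto.
case: pl pf => szl _ [szf _].
have [b bP bb] := pb_bounded_arg szl szf.
exists (fun a => sz (l a) * (b a + 1) + 1).
  by do !apply: pb_add || apply: pb_mul; do ?exact: pb_const.
move=> a i; rewrite foldlE sz_rev addn1.
apply: leq_trans (_ : sz (map (f a) (l a)) <= _); first by rewrite map_take sz_take.
apply: leq_trans (@sz_seq_le _ _ _ (b a) _) _; last first.
  by rewrite ltnS size_map addn1 leq_mul2r (ltnW (size_lt_sz _)) orbT.
have : sz (l a) <= sz (l a) by [].
elim: {1 3}(l a) => //= x s IH; rewrite sz_cons => xs.
by rewrite bb ?IH //; lia.
Qed.

Lemma pt_filter A {eA : Enc A} X {eX : Enc X} (p : A -> X -> bool) (l : A -> seq X) :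
  polytime l -> polytime (fun q : A * X => p q.1 q.2) -> polytime (fun a => filter (p a) (l a)).
Proof.
move=> pl pp.
have foldlE g (s : seq X) : foldl (fun s x => if g x then x :: s else s) [::] s = rev (filter g s).
  rewrite -[RHS]cats0; elim: s [::] => //= x s IH t.
  by rewrite IH; case: (g x) => //; rewrite rev_cons -cats1 -catA.
apply: (@pt_ext _ _ _ _ (fun a => rev (foldl (fun s x => if p a x then x :: s else s) [::] (l a)))) => [a|].
  by rewrite foldlE revK.
apply/pt_rev/(pt_foldl (step := fun a s x => if p a x then x :: s else s)) => //; first exact: pt_const.
  apply: pt_if; [ | by pt_auto | by pt_auto].
  by apply: (pt_comp (f := fun p : A * seq X * X => (p.1.1, p.2)) _ pp); pt_auto.
case: pl => szl _; exists (fun a => sz (l a)) => // a i.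
by rewrite foldlE sz_rev (leq_trans (sz_filter _ _)) // sz_take.
Qed.

Lemma pt_flatten A {eA : Enc A} X {eX : Enc X} (l : A -> seq (seq X)) :
  polytime l -> polytime (fun a => flatten (l a)).
Proof.
move=> pl.
have foldlE (s : seq (seq X)) : foldl cat [::] s = flatten s.
  rewrite -[RHS]cat0s; elim: s [::] => [t|x s IH t] /=; first by rewrite cats0.
  by rewrite IH catA.
apply: pt_ext (fun a => foldlE (l a)) _.
apply: (pt_foldl (step := fun _ => cat) (pt_const _) pl); first by cbv beta; apply: pt_cat; pt_auto.
case: pl => szl _; exists (fun a => sz (l a)) => // a i.
by rewrite foldlE (leq_trans (sz_flatten _)) // sz_take.
Qed.

Lemma pt_count A {eA : Enc A} X {eX : Enc X} (p : A -> X -> bool) (l : A -> seq X) :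
  polytime l -> polytime (fun q : A * X => p q.1 q.2) -> polytime (fun a => count (p a) (l a)).
Proof.
move=> pl pp; apply: (@pt_ext _ _ _ _ (fun a => size (filter (p a) (l a)))).
  by move=> a; rewrite size_filter.
by apply/pt_size/pt_filter.
Qed.

Lemma pt_all A {eA : Enc A} X {eX : Enc X} (p : A -> X -> bool) (l : A -> seq X) :
  polytime l -> polytime (fun q : A * X => p q.1 q.2) -> polytime (fun a => all (p a) (l a)).
Proof.
move=> pl pp; apply: (@pt_ext _ _ _ _ (fun a => count (p a) (l a) == size (l a))).
  by move=> a; rewrite all_count.
by apply: pt_eqn; [apply: pt_count | apply: pt_size].
Qed.

Lemma pt_mem A {eA : Enc A} (X : eqType) {eX : Enc X} (x : A -> X) (l : A -> seq X) :
  (polytime (fun p : X * X => p.1 == p.2)) -> polytime x -> polytime l -> polytime (fun a => x a \in l a).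
Proof.
move=> peq px pl.
apply: (@pt_ext _ _ _ _ (fun a => ~~ all (fun y => ~~ (x a == y)) (l a))).
  move=> a; rewrite -has_predC; apply/hasP/idP => [[y yl /=]|xl].
    by rewrite negbK => /eqP ->.
  by exists (x a); rewrite //= negbK.
apply/pt_negb/pt_all => //; apply: pt_negb.
by apply: (pt_comp (pt_pair (pt_comp (pt_fst pt_id) px) (pt_snd pt_id)) peq).
Qed.

Lemma pt_iota A {eA : Enc A} (n : A -> nat) :
  polytime n -> polytime (fun a => iota 0 (n a)).
Proof.
move=> pn.
have iterE k : iter k (fun s => size s :: s) [::] = rev (iota 0 k).
  elim: k => // k; rewrite iterS => ->.
  by rewrite size_rev size_iota -rev_rcons -cats1 -[k.+1 in RHS]addn1 iotaD add0n.
apply: (@pt_ext _ _ _ _ (fun a => rev (iter (n a) (fun s => size s :: s) [::]))).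
  by move=> a; rewrite iterE revK.
apply/pt_rev/(pt_iter (step := fun _ s => size s :: s)) => //; first exact: pt_const.
  by apply: pt_cons; [apply: pt_size; pt_auto | pt_auto].
case: pn => szn _; exists (fun a => sz (n a) * (sz (n a) + 1) + 1).
  by do !apply: pb_add || apply: pb_mul; do ?exact: pb_const.
move=> a i ia; rewrite iterE sz_rev.
apply: leq_trans (@sz_seq_le _ _ _ (sz (n a)) _) _.
  apply/allP => j; rewrite mem_iota => /andP[_ ji]; rewrite !sz_nat; lia.
rewrite size_iota addn1 ltnS addn1 leq_mul2r /=.
by rewrite sz_nat; lia.
Qed.

(** * Merging a path and a cycle *)

Lemma sorted_cat (T : Type) (e : rel T) x0 (s t : seq T) :
  sorted e (s ++ t) = [&& sorted e s, sorted e t &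
    nilp s || nilp t || e (last x0 s) (head x0 t)].
Proof.
case: s => [|x s] /=; first by rewrite andbT.
rewrite cat_path; case: t => [|y t] /=; first by rewrite !andbT.
by rewrite [e _ _ && _]andbC.
Qed.

(** * The search for a merged path *)

Section Search.
Variables (T : eqType) (x0 : T) (e : rel T).

(** A configuration [(R, x)] is a path [R] together with a vertex [x] missing
    from it. *)
Definition insertions (c : seq T * T) : seq (seq T) :=
  [seq take i c.1 ++ c.2 :: drop i c.1 | i <- iota 0 (size c.1).+1].

(** In a multipartite digraph, nonadjacency of the two swapped vertices means that they share a
    partite set. *)
Definition exchanges (c : seq T * T) : seq (seq T * T) :=
  [seq d <- [seq (take i c.1 ++ c.2 :: drop i.+1 c.1, nth c.2 c.1 i)
            | i <- iota 0 (size c.1)]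
  | [&& ~~ e c.2 d.2, ~~ e d.2 c.2 & sorted e d.1]].

(** Only one configuration is kept per free vertex, which keeps the list short. One is enough: by
    [reach_inv] the kept configurations agree at all positions outside the partite set of the free
    vertex. *)
Definition grow (cs : seq (seq T * T)) : seq (seq T * T) :=
  if [seq c <- flatten (map exchanges cs) | c.2 \notin map snd cs] is c :: _
  then c :: cs else cs.

(** There are [(size c.1).+1] vertices that can become free, so that many rounds exhaust the
    search. *)
Definition reach (c : seq T * T) := iter (size c.1).+1 grow [:: c].

(** All ways to leave out one vertex of the cycle and put the rest as a block into the path. The
    resulting sequence need not be a path. *)
Definition starts (P C : seq T) : seq (seq T * T) :=
  [seq (take j P ++ behead (rot i C) ++ drop j P, nth x0 C i)
  | j <- iota 0 (size P).+1, i <- iota 0 (size C)].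

Definition candidates (P C : seq T) : seq (seq T) :=
  flatten (map insertions (flatten (map reach (starts P C)))).

Definition merge_cycle (P C : seq T) : seq T :=
  head [::] (filter (sorted e) (candidates P C)).

Definition contents (c : seq T * T) := c.2 :: c.1.

Lemma insertions_perm c R : R \in insertions c -> perm_eq R (contents c).
Proof.
case/mapP=> i _ ->.
by rewrite perm_catC /= perm_cons perm_catC cat_take_drop.
Qed.

Lemma exchanges_perm c d :
  d \in exchanges c -> perm_eq (contents d) (contents c).
Proof.
rewrite mem_filter => /andP[_ /mapP[i]]; rewrite mem_iota => /andP[_ ic] ->.
rewrite /contents /= -[X in perm_eq _ (_ :: X)](cat_take_drop i) [drop i c.1](drop_nth c.2) //.
by apply/permP => a; rewrite /= !count_cat /=; lia.
Qed.

(** The step hypothesis concerns configurations of the final list, so that [reach_closed] can be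
    applied to them. *)
Lemma grow_ind (Q : seq T * T -> Prop) c k :
  Q c ->
  (forall c1 c2, c1 \in iter k grow [:: c] -> Q c1 -> c2 \in exchanges c1 -> Q c2) ->
  forall d, d \in iter k grow [:: c] -> Q d.
Proof.
move=> Qc; elim: k => [|k IH] Qs d; first by rewrite inE => /eqP ->.
have sub c1 : c1 \in iter k grow [:: c] -> c1 \in iter k.+1 grow [:: c].
  by rewrite iterS /grow; case: filter => // c2 cs; rewrite inE orbC => ->.
have {}IH : forall d, d \in iter k grow [:: c] -> Q d.
  by apply: IH => c1 c2 /sub; apply: Qs.
case: (boolP (d \in iter k grow [:: c])) => [/IH // | dN].
rewrite iterS /grow; case fE: filter => [|c2 cs] => [/IH //|].
rewrite inE => /orP[/eqP dE|/IH //]; rewrite {d}dE in dN *.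
have : c2 \in c2 :: cs by rewrite inE eqxx.
rewrite -fE mem_filter => /andP[_ /flattenP[l /mapP[c1 c1k ->] c2c1]].
by apply: Qs c2c1; [apply: sub | apply: IH].
Qed.

Lemma grow_perm c k d :
  d \in iter k grow [:: c] -> perm_eq (contents d) (contents c).
Proof.
move: d; apply: grow_ind => // c1 c2 _ p1 /exchanges_perm p2.
exact: perm_trans p2 p1.
Qed.

Lemma size_grow c k : size (iter k grow [:: c]) <= k.+1.
Proof.
elim: k => //= k IH; rewrite /grow; case: filter => [|d ds] /=; last by rewrite ltnS.
exact: leq_trans IH _.
Qed.

(** As long as some exchange frees a new vertex, a round adds one. Were this so in all
    [(size c.1).+1] rounds, there would be more distinct free vertices than vertices in
    [contents c]. *)
Lemma reach_closed c c1 c2 :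
  c1 \in reach c -> c2 \in exchanges c1 -> c2.2 \in map snd (reach c).
Proof.
pose stuck cs := nilp [seq c <- flatten (map exchanges cs) | c.2 \notin map snd cs].
suff st : stuck (reach c).
  move=> c1r c2c1; apply: contraTT st => c2N.
  rewrite /stuck /nilp size_filter -lt0n -has_count; apply/hasP; exists c2 => //.
  by apply/flattenP; exists (exchanges c1) => //; apply: map_f.
have stk k : stuck (iter k grow [:: c]) \/
    size (iter k grow [:: c]) = k.+1 /\ uniq (map snd (iter k grow [:: c])).
  elim: k => [|k IH]; first by right.
  rewrite iterS; set cs := iter k grow [:: c] in IH *.
  have [st|] := boolP (stuck cs).
    by left; rewrite /grow; move: (st); rewrite {1}/stuck; case: filter.
  case: IH => [-> //|[sk uk]] st; right; rewrite /grow.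
  move: st; rewrite /stuck; case fE: filter => [//|d ds] _ /=.
  split; first by rewrite sk.
  have : d \in d :: ds by rewrite inE eqxx.
  by rewrite -fE mem_filter uk andbT => /andP[].
case: (stk (size c.1).+1) => // -[szr uqr]; exfalso.
have : size (map snd (reach c)) <= size (contents c).
  apply: uniq_leq_size uqr _ => x /mapP[d /grow_perm dc ->].
  by rewrite -(perm_mem dc) inE eqxx.
by rewrite size_map [size _]szr /= ltnn.
Qed.

Lemma starts_perm P C c :
  c \in starts P C -> perm_eq (contents c) (P ++ C).
Proof.
case/allpairsP=> [[j i] [_ /= iC ->]].
rewrite mem_iota /= in iC; rewrite /contents /=.
have rE : rot i C = nth x0 C i :: behead (rot i C).
  by rewrite /rot (drop_nth x0).
apply/permP => a; have hP := congr1 (count a) (cat_take_drop j P).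
have /permP/(_ a) : perm_eq (rot i C) C by rewrite perm_rot.
by move: hP; rewrite rE /= !count_cat /=; lia.
Qed.

Lemma candidates_perm P C R :
  R \in candidates P C -> perm_eq R (P ++ C).
Proof.
case/flattenP=> l /mapP[c cr ->] /insertions_perm Rc.
have {cr}[l' /mapP[c0 c0s ->] cr] := flattenP cr.
apply: (perm_trans Rc); apply: (perm_trans (grow_perm cr)).
exact: starts_perm.
Qed.

Lemma reach_self c : c \in reach c.
Proof.
rewrite /reach; elim: (size c.1).+1 => [|k IH]; first by rewrite inE.
by rewrite iterS /grow; case: filter => // d ds; rewrite inE IH orbT.
Qed.

(** Each vertex of [s] with its two neighbours on the walk [z :: s]; the second neighbour is missing
    at the end. *)
Fixpoint gaps (z : T) (s : seq T) : seq (T * T * option T) :=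
  if s is u :: s' then (z, u, ohead s') :: gaps u s' else [::].

Lemma mem_gaps z s g : g \in gaps z s ->
  exists L1 L2, z :: s = L1 ++ [:: g.1.1, g.1.2 & L2] /\ g.2 = ohead L2.
Proof.
elim: s z => //= u s IH z; rewrite inE => /orP[/eqP -> /=|/IH[L1 [L2 [-> ->]]]].
  by exists [::], s.
by exists (z :: L1), L2.
Qed.

(* Telescoping along the vertices outside [inA]: a gap filled by a vertex of
   [inA] is skipped, and it matters only if that vertex is in [inS]. *)
Lemma gap_count (h inA inS : pred T) z s :
  ~~ inA z -> sorted (fun x y => ~~ (inA x && inA y)) (z :: s) ->
  subpred inS inA ->
  (forall p u n, (p, u, n) \in gaps z s ->
     if inA u then inS u || (h p ==> oapp h false n) else inA p || (h p ==> h u)) ->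
  h z + \sum_(g <- gaps z s | inS g.1.2) oapp h false g.2
    <= \sum_(g <- gaps z s | inS g.1.2) h g.1.1 + h (last z s).
Proof.
move=> zA + SA; have [n] := ubnP (size s).
pose N y r := \sum_(g <- gaps y r | inS g.1.2) oapp h false g.2.
pose M y r := \sum_(g <- gaps y r | inS g.1.2) h g.1.1.
have Ncons y u r : N y (u :: r) = inS u * oapp h false (ohead r) + N u r.
  by rewrite /N /= big_cons /=; case: (inS u); rewrite ?mul1n.
have Mcons y u r : M y (u :: r) = inS u * h y + M u r.
  by rewrite /M /= big_cons /=; case: (inS u); rewrite ?mul1n.
rewrite -/(N z s) -/(M z s).
elim: n => // n IH in z s zA *; case: s => [|u [|w s]] sn srt gP.
- by rewrite /N /M !big_nil /= addnC.
- have := gP z u None; rewrite inE eqxx => /(_ isT).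
  rewrite Ncons Mcons /N /M !big_nil /= (negbTE zA).
  case: (boolP (inS u)) => [uS|_]; first by rewrite (SA _ uS); lia.
  by case: (inA u); case: (h z); case: (h u).
have gP1 p u' n' : (p, u', n') \in gaps u (w :: s) ->
     if inA u' then inS u' || (h p ==> oapp h false n') else inA p || (h p ==> h u').
  by move=> g; apply: gP; rewrite /= inE g orbT.
have := gP z u (Some w); rewrite inE eqxx => /(_ isT).
(* If [u] is in [inA], the induction jumps from [z] to [w]. When [u] is in [inS], its own terms
   account for the change from [h z] to [h w]; otherwise [h] cannot drop there. *)
have [uA|uA] := boolP (inA u).
  have wA : ~~ inA w by case/and3P: srt => _; rewrite uA.
  have wS : inS w = false by apply: contraNF wA => /SA.
  have gP2 p u' n' : (p, u', n') \in gaps w s ->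
       if inA u' then inS u' || (h p ==> oapp h false n') else inA p || (h p ==> h u').
    by move=> g; apply: gP1; rewrite /= inE g orbT.
  have := IH w s wA (ltnW sn) (path_sorted (path_sorted srt)) gP2.
  rewrite !(Ncons, Mcons) wS /=.
  by case: (inS u) => /=; case: (h z); case: (h w) => //=; lia.
have := IH u (w :: s) uA sn (path_sorted srt) gP1.
have uS : inS u = false by apply: contraNF uA => /SA.
by rewrite (Ncons z) (Mcons z) uS (negbTE zA) /=; case: (h z); case: (h u) => //=; lia.
Qed.

Section Merge.
Variables (K : eqType) (key : T -> K).

Definition multipartite_on (s : seq T) :=
  {in s &, forall x y, e x y || e y x = (key x != key y)}.

Lemma multipartite_arc s x y :
  multipartite_on s -> x \in s -> y \in s -> e x y -> key x != key y.
Proof. by move=> mp xs ys xy; rewrite -mp // xy. Qed.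

(** * Configurations reached from a start that is a path *)

Section Reach.
Variables (R0 : seq T) (v0 : T).
Hypothesis mp : multipartite_on (v0 :: R0).
Hypothesis R0_path : sorted e R0.
Let A := key v0.
Let S := map snd (reach (R0, v0)).

(** Exchanges stay inside the partite set [A], so positions outside it never change. A position that
    has changed had its original vertex freed at some moment, which puts that vertex into [S]. *)
Lemma reach_inv c : c \in reach (R0, v0) ->
  [/\ size c.1 = size R0, sorted e c.1, perm_eq (contents c) (v0 :: R0), key c.2 = A &
     forall i, i < size R0 -> nth x0 c.1 i = nth x0 R0 i \/
       [/\ key (nth x0 c.1 i) = A, key (nth x0 R0 i) = A & nth x0 R0 i \in S]].
Proof.
move: c; apply: grow_ind => [|c1 c2 c1r [sz1 srt1 p1 k1 nth1] c2c1].
  by split=> // i; left.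
have p2 := perm_trans (exchanges_perm c2c1) p1.
have c2S := reach_closed c1r c2c1.
move: c2c1; rewrite mem_filter => /andP[/and3P[n12 n21 srt2] /mapP[i]].
rewrite mem_iota => /andP[_ /= ic c2E].
have k2 : key c2.2 = A.
  rewrite -k1; apply/eqP; rewrite eq_sym -[_ == _]negbK -mp ?(negbTE n12) ?(negbTE n21) //.
    by rewrite -(perm_mem p1) inE eqxx.
  by rewrite -(perm_mem p2) inE eqxx.
have szt : size (take i c1.1) = i by rewrite size_take ic.
split=> //.
  by rewrite c2E /= size_cat /= size_drop szt -sz1 subnSK // subnKC // ltnW.
move=> j jR; rewrite c2E /= nth_cat szt.
case: (ltngtP j i) => ji.
- by rewrite nth_take //; apply: nth1.
- by rewrite -(subnSK ji) /= nth_drop subnKC //; apply: nth1.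
- rewrite ji subnn /=; have := nth1 _ jR; rewrite ji.
  have c2n : c2.2 = nth x0 c1.1 i by rewrite c2E /=; apply: set_nth_default.
  case=> [nE|[kE kR nS]]; right; split=> //.
  + by rewrite -nE -c2n.
  + by rewrite -nE -c2n.
Qed.

Lemma reach_key x : x \in S -> key x = A /\ x \in v0 :: R0.
Proof.
case/mapP=> c /reach_inv[_ _ pc kc _] ->; split=> //.
by rewrite -(perm_mem pc) inE eqxx.
Qed.

Lemma path_key i : i.+1 < size R0 ->
  key (nth x0 R0 i) != key (nth x0 R0 i.+1).
Proof.
move=> iR; apply: (multipartite_arc mp).
- by rewrite inE mem_nth ?orbT // ltnW.
- by rewrite inE mem_nth ?orbT.
by move/(sortedP x0): R0_path; apply.
Qed.

Lemma reach_fixed c i : c \in reach (R0, v0) -> i < size R0 ->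
  key (nth x0 R0 i) != A -> nth x0 c.1 i = nth x0 R0 i.
Proof.
move=> /reach_inv[_ _ _ _ nthc] iR; case: (nthc i iR) => // -[_ -> _].
by rewrite eqxx.
Qed.

(** The neighbours of a vertex of [A] on [R0] lie outside [A] and are still in place in the
    configuration that leaves out [x], so the exchange is possible there. If the position has
    already changed, its vertex is in [S] anyway. *)
Lemma reach_exchange x i : x \in S -> i.+1 < size R0 ->
  key (nth x0 R0 i.+1) = A -> e (nth x0 R0 i) x ->
  (i.+2 < size R0 -> e x (nth x0 R0 i.+2)) -> nth x0 R0 i.+1 \in S.
Proof.
case/mapP=> c cr -> iR kA ex xe.
have [szc srtc pc kc nthc] := reach_inv cr.
case: (nthc _ iR) => [nE|[] //].
have kpre : key (nth x0 R0 i) != A by rewrite -kA path_key.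
have ksuc : i.+2 < size R0 -> key (nth x0 R0 i.+2) != A.
  by move=> iR2; rewrite -kA eq_sym path_key.
have ic : i.+1 < size c.1 by rewrite szc.
have nE' : nth c.2 c.1 i.+1 = nth x0 R0 i.+1 by rewrite -nE; apply: set_nth_default.
rewrite -nE'; apply: (reach_closed (c2 := (_, _)) cr).
rewrite mem_filter; apply/andP; split; last first.
  by apply/mapP; exists i.+1; rewrite // mem_iota.
have yd : nth x0 R0 i.+1 \in v0 :: R0 by rewrite inE mem_nth ?orbT.
have xd : c.2 \in v0 :: R0 by rewrite -(perm_mem pc) inE eqxx.
apply/and3P; rewrite /= nE'; split.
- by have := mp xd yd; rewrite kc kA eqxx; case: (e _ _).
- by have := mp yd xd; rewrite kc kA eqxx; case: (e _ _).
have szt : size (take i.+1 c.1) = i.+1 by rewrite size_take ic.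
have nthE j : nth x0 (take i.+1 c.1 ++ c.2 :: drop i.+2 c.1) j =
    if j == i.+1 then c.2 else nth x0 c.1 j.
  rewrite nth_cat szt; case: (ltngtP j i.+1) => [ji|ji|->]; last by rewrite subnn.
  - by rewrite nth_take.
  - by rewrite -(subnSK ji) /= nth_drop subnKC.
apply/(sortedP x0) => j; rewrite size_cat /= size_drop szt addnS -addSn subnKC // !nthE => jc.
have [jE|ji] := eqVneq j i.+1.
  rewrite {}jE in jc *; rewrite eqSS -[i.+1 == i]/(i.+1 == i) gtn_eqF //.
  by rewrite (reach_fixed cr) -?szc ?ksuc ?xe -?szc.
case: eqVneq => [[jE]|_]; last by move/(sortedP x0): srtc; apply.
by rewrite jE (reach_fixed cr) // ltnW.
Qed.

(** Both vertices are outside [A], hence still consecutive in the configuration that leaves out [x];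
    arcs into and out of [x] would make an insertion succeed. *)
Lemma reach_insert x i :
  (forall c R, c \in reach (R0, v0) -> R \in insertions c -> ~~ sorted e R) ->
  x \in S -> i.+1 < size R0 ->
  key (nth x0 R0 i) != A -> key (nth x0 R0 i.+1) != A ->
  e (nth x0 R0 i) x -> ~~ e x (nth x0 R0 i.+1).
Proof.
move=> fails /mapP[c cr ->] iR k0 k1 ex.
have [szc srtc pc kc nthc] := reach_inv cr.
have ic : i.+1 < size c.1 by rewrite szc.
have Rin : take i.+1 c.1 ++ c.2 :: drop i.+1 c.1 \in insertions c.
  by apply/mapP; exists i.+1; rewrite // mem_iota /= ltnW // ltnW.
apply: contraNN (fails _ _ cr Rin) => xe.
have szt : size (take i.+1 c.1) = i.+1 by rewrite size_take ic.
rewrite (sorted_cat _ x0) (take_sorted _ srtc) /=.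
rewrite -nth_last szt /= nth_take // (reach_fixed cr) ?ex ?(ltnW iR) //.
rewrite (drop_nth x0) //= (reach_fixed cr) // xe orbT andbT /=.
by have := drop_sorted i.+1 srtc; rewrite (drop_nth x0) // (reach_fixed cr).
Qed.

End Reach.

(** * Contradiction from a cycle that cannot be merged *)

Section MergeCycle.
Variables P C : seq T.
Hypotheses (P_gt0 : P != [::]) (P_path : sorted e P).
Hypotheses (C_gt1 : 1 < size C) (C_cycle : cycle e C).
Hypothesis mp : multipartite_on (P ++ C).

(* [b] follows [a] on the cycle [C]. *)
Definition cycle_step a b := exists i r, rot i C = b :: r /\ last b r = a.

Lemma cycle_step_arc a b : cycle_step a b -> e a b.
Proof.
case=> i [r [ir <-]]; have : cycle e (b :: r) by rewrite -ir rot_cycle.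
by rewrite /= rcons_path => /andP[].
Qed.

Lemma cycle_step_mem a b : cycle_step a b -> a \in C /\ b \in C.
Proof.
case=> i [r [ir <-]].
by rewrite -!(mem_rot i C) ir mem_last inE eqxx.
Qed.

Lemma cycle_step_split i L1 a b L2 :
  rot i C = L1 ++ [:: a, b & L2] -> cycle_step a b.
Proof.
move=> iC.
have [k kC] : exists k, rot (size L1).+1 (rot i C) = rot k C.
  have [iC'|/ltnW iC'] := leqP i (size C); last first.
    by exists (size L1).+1; rewrite (rot_oversize iC').
  exists (if (size L1).+1 + i <= size C then (size L1).+1 + i else (size L1).+1 + i - size C).
  have LC : (size L1).+1 <= size C by rewrite -(size_rot i C) iC size_cat /=; lia.
  by rewrite rot_add_mod.
exists k, (L2 ++ L1 ++ [:: a]); rewrite -kC iC; split; last by rewrite catA last_cat.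
by rewrite -cat_rcons -(size_rcons L1 a) rot_size_cat -cats1 /= .
Qed.

Lemma cycle_step_from a : a \in C -> exists b, cycle_step a b.
Proof.
move=> aC; have := rot_index aC; set r := _ ++ _ => aE.
case: r aE => [|b r] aE; first by move: C_gt1; rewrite -(size_rot (index a C)) aE.
by exists b; apply: (@cycle_step_split _ [::] _ _ r aE).
Qed.

Lemma cycle_step_to b : b \in C -> exists a, cycle_step a b.
Proof.
move=> bC; have := rot_index bC; set r := _ ++ _ => bE.
by exists (last b r), (index b C), r.
Qed.

Hypothesis fails : ~~ has (sorted e) (candidates P C).

Lemma reach_fails c0 c R : c0 \in starts P C -> c \in reach c0 ->
  R \in insertions c -> ~~ sorted e R.
Proof.
move=> c0s cr Rc; apply: (hasPn fails); apply/flattenP; exists (insertions c) => //.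
by apply/map_f/flattenP; exists (reach c0) => //; apply: map_f.
Qed.

Lemma start_mem X Y i : P = X ++ Y -> i < size C ->
  (X ++ behead (rot i C) ++ Y, nth x0 C i) \in starts P C.
Proof.
move=> PE iC; apply/allpairsP; exists (size X, i); split.
- by rewrite mem_iota /= ltnS PE size_cat leq_addr.
- by rewrite mem_iota.
- by rewrite /= PE take_size_cat // drop_size_cat.
Qed.

Lemma rot_small i : exists2 j, j < size C & rot i C = rot j C.
Proof.
case: (ltnP i (size C)) => [iC|iC]; first by exists i.
by exists 0; [apply: ltnW C_gt1 | rewrite rot_oversize // rot0].
Qed.

(** Inserting the whole cycle is a candidate: leave out its first vertex and put it straight
    back. *)
Lemma no_cycle_insertion X Y i : P = X ++ Y -> ~~ sorted e (X ++ rot i C ++ Y).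
Proof.
move=> PE; have [{}i iC ->] := rot_small i.
apply: reach_fails (start_mem PE iC) (reach_self _) _.
apply/mapP; exists (size X); first by rewrite mem_iota /= ltnS size_cat leq_addr.
rewrite /= take_size_cat // drop_size_cat //; congr (_ ++ _).
by rewrite /rot (drop_nth x0).
Qed.

(** Without the arc from [a] to [b], the cycle is a path from [b] to [a], which would fit between
    [X] and [Y]. *)
Lemma no_insertion X Y a b : P = X ++ Y -> cycle_step a b ->
  ~~ ((nilp X || e (last x0 X) b) && (nilp Y || e a (head x0 Y))).
Proof.
move=> PE [i [r [ir <-]]]; apply: contra (no_cycle_insertion i PE) => /andP[Xb bY].
move: P_path; rewrite PE (sorted_cat _ x0) => /and3P[Xp Yp _].
have : cycle e (b :: r) by rewrite -ir rot_cycle.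
rewrite /= rcons_path => /andP[rp _].
by rewrite ir !(sorted_cat _ x0) Xp Yp /= rp /= orbF Xb bY.
Qed.

Lemma no_insertion_mid X x y Y a b : P = X ++ [:: x, y & Y] -> cycle_step a b ->
  ~~ (e x b && e a y).
Proof.
move=> PE ab; have := @no_insertion (rcons X x) (y :: Y) a b.
by rewrite cat_rcons last_rcons /nilp size_rcons => /(_ PE ab).
Qed.

Lemma no_insertion_first y Y a : P = y :: Y -> a \in C -> ~~ e a y.
Proof. by move=> PE /cycle_step_from[b ab]; apply: (@no_insertion [::] _ a b PE ab). Qed.

Lemma no_insertion_last b : b \in C -> ~~ e (last x0 P) b.
Proof.
case/cycle_step_to=> a ab.
have := @no_insertion P [::] a b; rewrite cats0 => /(_ erefl ab).
by rewrite andbT /nilp size_eq0 (negbTE P_gt0).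
Qed.

Lemma last_mem : last x0 P \in P.
Proof. by case: P P_gt0 => //= p P' _; apply: mem_last. Qed.

(** [q] is the first vertex of [P] that receives an arc from [C]. The last vertex of [P] receives
    one, as it sends none to [C] and is adjacent to some vertex of [C]; the first vertex of [P]
    receives none, so [q] has a predecessor [a]. *)
Lemma split_path : exists X a q Y c,
  [/\ P = X ++ [:: a, q & Y], c \in C, e c q & {in C, forall d, ~~ e d a}].
Proof.
pose hit p := has (fun c => e c p) C.
have hitP : has hit P.
  apply/hasP; exists (last x0 P); first exact: last_mem.
  have lP : last x0 P \in P ++ C by rewrite mem_cat last_mem.
  (* Two consecutive vertices of [C] are in different partite sets, so one of them avoids that of
     [last x0 P]. *)
  have [c cC kc] : exists2 c, c \in C & key c != key (last x0 P).
    case: C C_gt1 C_cycle (mp) => [|c1 [|c2 C']] // _ /= /andP[c12 _] mpC.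
    have [k1|k1] := eqVneq (key c1) (key (last x0 P)); last by exists c1; rewrite ?inE ?eqxx.
    exists c2; first by rewrite !inE eqxx orbT.
    by rewrite -k1 eq_sym (multipartite_arc mpC) // mem_cat !inE eqxx ?orbT.
  apply/hasP; exists c => //; move: kc; rewrite -mp ?mem_cat ?cC ?orbT //.
    by rewrite (negbTE (no_insertion_last cC)) orbF.
  by rewrite -mem_cat.
have k_gt0 : 0 < find hit P.
  case PE: P P_gt0 => [//|y Y] _ /=; case: ifP => // /hasP[c cC].
  by rewrite (negbTE (no_insertion_first PE cC)).
have kP : find hit P < size P by rewrite -has_find.
move: kP k_gt0 (nth_find x0 hitP) (@before_find _ x0 hit P).
case: (find hit P) => // k kP _ /hasP[c cC cq] /(_ k (ltnSn k))/negbT/hasPn noa.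
exists (take k P), (nth x0 P k), (nth x0 P k.+1), (drop k.+2 P), c; split=> //.
by rewrite -(drop_nth x0) // -(drop_nth x0) ?cat_take_drop // ltnW.
Qed.

Lemma merge_cycle_contradiction : False.
Proof.
have [X [a [q [Y [c [PE cC cq noa]]]]]] := split_path.
have [v0 cv0] := cycle_step_from cC; have [i [M [iM Mc]]] := cv0.
have {i iM} [i iC iM] : exists2 i, i < size C & rot i C = v0 :: M.
  by have [j jC ij] := rot_small i; exists j; rewrite -?ij.
have aD : a \in P ++ C by rewrite mem_cat PE mem_cat inE eqxx !orbT.
have qD : q \in P ++ C by rewrite mem_cat PE mem_cat !inE eqxx !orbT.
have CD d : d \in C -> d \in P ++ C by rewrite mem_cat orbC => ->.
have YD d : d \in Y -> d \in P ++ C by rewrite mem_cat PE mem_cat !inE => ->; rewrite !orbT.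
have [_ v0C] := cycle_step_mem cv0.
have v0A : key v0 = key a.
  (* [v0] sends no arc to [a] by the choice of [a], and an arc from [a] to [v0] together with [c q]
     would insert [C] between [a] and [q]. *)
  apply/eqP; rewrite eq_sym -[_ == _]negbK -mp ?(CD v0) //.
  rewrite (negbTE (noa _ v0C)) orbF.
  by have := no_insertion_mid PE cv0; rewrite cq andbT.
pose A := key a.
have aq : e a q by move: P_path; rewrite PE (sorted_cat _ x0) => /and3P[_ /= /andP[]].
have qA : key q != A by rewrite eq_sym (multipartite_arc mp).
have cA : key c != A by rewrite /A -v0A (multipartite_arc mp) ?CD // (cycle_step_arc cv0).
have PE' : P = rcons X a ++ q :: Y by rewrite cat_rcons.
(* [M] runs from the successor of [v0] round the cycle to [c], so [R0] lacks only [v0]. *)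
pose R0 := rcons X a ++ M ++ q :: Y.
have R0s : (R0, v0) \in starts P C.
  have nv : nth x0 C i = v0 by move: iM; rewrite /rot (drop_nth x0 iC) => -[].
  by have := start_mem PE' iC; rewrite iM nv.
have mpR : multipartite_on (v0 :: R0).
  by move=> x y xR yR; apply: mp; rewrite -(perm_mem (starts_perm R0s)).
have C_path : path e c (v0 :: M).
  have : cycle e (v0 :: M) by rewrite -iM rot_cycle.
  by rewrite /= rcons_path Mc => /andP[-> ->].
have MC d : d \in v0 :: M -> d \in C by rewrite -iM mem_rot.
have MD d : d \in v0 :: M -> d \in P ++ C by move/MC/CD.
have [m [M' ME]] : exists m M', M = m :: M'.
  by case: (M) iM => [|m M' _]; [move=> iM; move: C_gt1; rewrite -(size_rot i) iM | exists m, M'].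
have mC : m \in v0 :: M by rewrite ME !inE eqxx orbT.
have vm : e v0 m by move: C_path; rewrite ME /= => /and3P[].
have noA x y : x \in P ++ C -> y \in P ++ C -> key x = A -> ~~ e x y -> key y != A -> e y x.
  by move=> xD yD xA xy yA; have := mp xD yD; rewrite (negbTE xy) xA eq_sym yA.
have noA' x y : x \in P ++ C -> y \in P ++ C -> key x = A -> ~~ e y x -> key y != A -> e x y.
  by move=> xD yD xA yx yA; have := mp xD yD; rewrite (negbTE yx) orbF xA eq_sym yA.
have mA : key m != A.
  by rewrite /A -v0A eq_sym; apply: multipartite_arc mp (MD _ (mem_head _ _)) (MD _ mC) vm.
have R0_path : sorted e R0.
  have am : e a m by apply: noA' => //; [exact: MD | apply/noa/MC].
  have lM : last m M' = c by rewrite -Mc ME.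
  move: P_path; rewrite PE' (sorted_cat _ x0) => /and3P[Xp Yp _].
  rewrite /R0 !(sorted_cat _ x0) Xp Yp ME /=.
  by move: C_path; rewrite ME /= lM cq last_rcons am orbT => /and3P[_ _ ->].
pose S := map snd (reach (R0, v0)).
have v0S : v0 \in S by apply/mapP; exists (R0, v0) => //; apply: reach_self.
have SA x : x \in S -> key x == A by case/(reach_key mpR R0_path) => -> _; rewrite v0A.
have fl c1 R : c1 \in reach (R0, v0) -> R \in insertions c1 -> ~~ sorted e R.
  exact: reach_fails R0s.
have R0D x : x \in R0 -> x \in P ++ C.
  by move=> xR; rewrite -(perm_mem (starts_perm R0s)) inE xR orbT.
(* The hypothesis of [gap_count] for arcs into [x] in [S], along [R0]: a vertex of [A] that [x]
   could replace is in [S], and between two vertices outside [A] [x] cannot be inserted. *)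
have ifA L1 p u L2 x : R0 = L1 ++ [:: p, u & L2] -> x \in S ->
    if key u == A then (u \in S) || (e p x ==> oapp (e^~ x) false (ohead L2))
    else (key p == A) || (e p x ==> e u x).
  move=> RE xS; have [xA xR] := reach_key mpR R0_path xS.
  have xD : x \in P ++ C by rewrite -(perm_mem (starts_perm R0s)).
  have iR : (size L1).+1 < size R0 by rewrite RE size_cat /= !addnS !ltnS leq_addr.
  have pE : nth x0 R0 (size L1) = p by rewrite RE nth_cat ltnn subnn.
  have uE : nth x0 R0 (size L1).+1 = u by rewrite RE nth_cat ltnNge leqnSn subSnn.
  have uD : u \in P ++ C by apply: R0D; rewrite -uE mem_nth.
  case: (boolP (key u == A)) => [/eqP uA|uA].
    rewrite -implyNb; apply/implyP => uS; apply/implyP => px.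
    apply: contraR uS => nx; rewrite -uE.
    apply: (reach_exchange mpR R0_path xS iR); rewrite ?uE ?pE ?v0A //.
    move=> iR2; have := path_key mpR R0_path iR2; rewrite uE uA eq_sym.
    case: L2 RE nx => [|n L2] RE nx; first by move: iR2; rewrite RE size_cat /= addn2 ltnn.
    have nE : nth x0 R0 (size L1).+2 = n by rewrite RE nth_cat ltnNge -addn2 leq_addr addnC addnK.
    by rewrite nE => nA; apply: noA' => //; [apply: R0D; rewrite -nE mem_nth | rewrite xA].
  case: (boolP (key p == A)) => //= pA; apply/implyP => px.
  apply: (noA x) => //; first by rewrite xA v0A.
  by have := reach_insert mpR R0_path fl xS iR; rewrite pE uE v0A; apply.
have alt s : {subset s <= P ++ C} -> sorted e s ->
    sorted (fun x y => ~~ ((key x == A) && (key y == A))) s.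
  move=> sD; apply: (@sub_in_sorted _ (mem (P ++ C))); last exact/allP.
  move=> x y xD yD xy; apply: contra (multipartite_arc mp xD yD xy).
  by case/andP=> /eqP -> /eqP ->.
have QP : sorted e (q :: Y) by move: P_path; rewrite PE' (sorted_cat _ x0) => /and3P[].
have QD : {subset q :: Y <= P ++ C} by move=> x; rewrite inE => /orP[/eqP -> | /YD].
(* The walk [c :: v0 :: M] goes once round [C] and ends in [c], outside [A]; so every vertex of [A]
   on it has a successor. *)
have stepC p v n : (p, v, n) \in gaps c (v0 :: M) -> key v = A ->
    exists n', [/\ n = Some n', cycle_step p v & cycle_step v n'].
  case/mem_gaps=> L1 [L2 [/= CE ->]] vA.
  case: L2 CE => [|w L2] CE.
    have : last c (v0 :: M) = v by rewrite -[LHS](last_cons c) CE last_cat.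
    by rewrite /= Mc => cv; move: cA; rewrite cv vA eqxx.
  exists w; split=> //; case: L1 CE => [[cE vE MwE]|c' L1 [cE CE]].
  - by rewrite -cE -vE.
  - by apply: (@cycle_step_split i L1 p v (w :: L2)); rewrite iM CE.
  - by apply: (@cycle_step_split i [::] v w L2); rewrite iM vE MwE.
  - by apply: (@cycle_step_split i (rcons L1 p) v w L2); rewrite iM CE cat_rcons.
(* Along [q :: Y], arcs to [v] start at [q] and have stopped by the end. *)
have rowv p v n : (p, v, n) \in gaps c (v0 :: M) -> v \in S ->
   1 + \sum_(g <- gaps q Y | g.1.2 \in S) oapp (e^~ v) false g.2
     <= \sum_(g <- gaps q Y | g.1.2 \in S) e g.1.1 v.
  move=> gv vS; have vA := eqP (SA _ vS).
  have [n' [_ pv vn]] := stepC _ _ _ gv vA.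
  have [pC vC] := cycle_step_mem pv; have [_ nC] := cycle_step_mem vn.
  have nA : key n' != A by rewrite -vA eq_sym (multipartite_arc mp) ?CD // cycle_step_arc.
  (* [a] sends an arc to the successor [n'] of [v], as [C] sends none to [a]. An arc from [v] to [q]
     would therefore insert [C] between [a] and [q]. *)
  have qv : e q v.
    apply: noA => //; first exact: CD.
    have := no_insertion_mid PE vn; rewrite (noA' a) //; [exact: CD | exact: noa].
  have := @gap_count (e^~ v) (fun x => key x == A) (fun x => x \in S) q Y qA _ SA.
  have -> : e (last q Y) v = false.
    by apply/negbTE; have := no_insertion_last vC; rewrite PE last_cat.
  rewrite qv addn0; apply; first exact: alt.
  move=> p' u n1 /mem_gaps[L1 [L2 [/= QE ->]]]; apply: (ifA (rcons X a ++ M ++ L1)) => //.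
  by rewrite /R0 QE -!catA.
(* Around the closed walk from [c] to [c] the changes cancel. *)
have colu p u n : (p, u, n) \in gaps q Y -> u \in S ->
   \sum_(g <- gaps c (v0 :: M) | g.1.2 \in S) oapp (e^~ u) false g.2
     <= \sum_(g <- gaps c (v0 :: M) | g.1.2 \in S) e g.1.1 u.
  move=> gu uS; have uA := eqP (SA _ uS).
  have := @gap_count (e^~ u) (fun x => key x == A) (fun x => x \in S) c (v0 :: M) cA _ SA.
  rewrite [last c _]/= Mc [X in _ <= X]addnC leq_add2l; apply.
    by apply: (alt (c :: v0 :: M)) => // x; rewrite inE => /orP[/eqP -> | /MD //]; apply: CD.
  move=> p' w n1 /mem_gaps[L1 [L2 [/= CE ->]]].
  (* [v0] is not on [R0], so the gaps at [v0] and [m] are treated separately: [v0] is in [S], and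
     the predecessor of [m] is in [A]. *)
  case: L1 CE => [[_ <- _]|c' L1 [_ CE]]; first by rewrite v0A eqxx v0S.
  case: L1 CE => [[<-]|v0' L1 [_ CE]].
    by rewrite ME => -[<- _]; rewrite (negbTE mA) v0A eqxx.
  have /(ifA (rcons X a ++ L1) p' w (L2 ++ q :: Y) u) : R0 = (rcons X a ++ L1) ++ [:: p', w & L2 ++ q :: Y].
    by rewrite /R0 CE -!catA.
  (* At the end of [M] the successor is [q] on [R0] but missing on the walk. The vertex there is
     [c], outside [A], and for such a vertex the condition does not mention the successor. *)
  move=> /(_ uS); case: L2 CE => [|n2 L2] //= CE.
  have -> // : w = c by rewrite -Mc CE last_cat.
  by rewrite (negbTE cA).
(* Otherwise [C] could be inserted as a whole next to [u]. *)
have ler (gv gu : T * T * option T) : gv \in gaps c (v0 :: M) -> gv.1.2 \in S ->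
    gu \in gaps q Y -> gu.1.2 \in S ->
    e gu.1.1 gv.1.2 + e gv.1.1 gu.1.2 <=
    oapp (e^~ gv.1.2) false gu.2 + oapp (e^~ gu.1.2) false gv.2.
  case: gv gu => [[p v] n] [[p' u] n'] /= gv vS gu uS.
  have vA := eqP (SA _ vS); have uA := eqP (SA _ uS).
  have [w [-> pv vw]] := stepC _ _ _ gv vA; have [_ vC] := cycle_step_mem pv.
  have [_ wC] := cycle_step_mem vw.
  have wA : key w != A by rewrite -vA eq_sym (multipartite_arc mp) ?CD // cycle_step_arc.
  have [L1 [L2 [/= QE ->]]] := mem_gaps gu.
  have PE1 : P = (rcons X a ++ L1) ++ [:: p', u & L2] by rewrite PE' QE -!catA.
  have uD : u \in P ++ C by apply: QD; rewrite QE mem_cat !inE eqxx !orbT.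
  have := no_insertion_mid PE1 pv.
  (* Inserting [C] before [u] is impossible, so the left side is at most 1. The right side is
     positive because [C] cannot be inserted after [u] either. *)
  suff : oapp (e^~ v) false (ohead L2) || e w u.
    by case: (oapp _ _ _); case: (e w u); case: (e p' v); case: (e p u).
  case: L2 QE PE1 => [|y L2] QE PE1 /=.
    have uw := no_insertion_last wC; rewrite PE1 last_cat /= in uw.
    by apply: noA => //; exact: CD.
  have PE2 : P = (rcons X a ++ rcons L1 p') ++ [:: u, y & L2] by rewrite PE1 -!catA (cat_rcons p').
  have yD : y \in P ++ C by apply: QD; rewrite QE mem_cat !inE eqxx !orbT.
  have yA : key y != A.
    rewrite -uA eq_sym (multipartite_arc mp) //.
    by move: P_path; rewrite PE2 (sorted_cat _ x0) => /and3P[_ /= /andP[]].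
  have := no_insertion_mid PE2 vw; apply: contraNT; rewrite negb_or => /andP[yv wu].
  by rewrite (noA' u w) ?(noA' v y) ?(CD v) ?(CD w).
pose GC := [seq g <- gaps c (v0 :: M) | g.1.2 \in S].
pose GQ := [seq g <- gaps q Y | g.1.2 \in S].
have s1 : size GC + \sum_(gv <- GC) \sum_(gu <- GQ) oapp (e^~ gv.1.2) false gu.2
    <= \sum_(gv <- GC) \sum_(gu <- GQ) e gu.1.1 gv.1.2.
  rewrite -sum1_size -big_split /= big_seq [X in _ <= X]big_seq.
  apply: leq_sum => -[[p v] o]; rewrite mem_filter => /andP[vS gv].
  by rewrite !big_filter; apply: rowv gv vS.
have s2 : \sum_(gu <- GQ) \sum_(gv <- GC) oapp (e^~ gu.1.2) false gv.2
    <= \sum_(gu <- GQ) \sum_(gv <- GC) e gv.1.1 gu.1.2.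
  rewrite big_seq [X in _ <= X]big_seq.
  apply: leq_sum => -[[p u] n]; rewrite mem_filter => /andP[uS gu].
  by rewrite !big_filter; apply: colu gu uS.
have s3 : \sum_(gv <- GC) \sum_(gu <- GQ) (e gu.1.1 gv.1.2 + e gv.1.1 gu.1.2) <=
    \sum_(gv <- GC) \sum_(gu <- GQ)
      (oapp (e^~ gv.1.2) false gu.2 + oapp (e^~ gu.1.2) false gv.2).
  rewrite big_seq [X in _ <= X]big_seq; apply: leq_sum => gv.
  rewrite mem_filter => /andP[vS gvC].
  rewrite big_seq [X in _ <= X]big_seq; apply: leq_sum => gu.
  by rewrite mem_filter => /andP[uS guQ]; apply: ler.
have GC_gt0 : 0 < size GC by rewrite /GC /= v0S.
have sumD (F G : T * T * option T -> T * T * option T -> nat) :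
    \sum_(gv <- GC) \sum_(gu <- GQ) (F gv gu + G gv gu) =
    \sum_(gv <- GC) \sum_(gu <- GQ) F gv gu + \sum_(gv <- GC) \sum_(gu <- GQ) G gv gu.
  by rewrite -big_split; apply: eq_bigr => gv _; rewrite big_split.
rewrite [X in X <= _]exchange_big [X in _ <= X]exchange_big /= in s2.
rewrite !sumD in s3.
(* Rows and columns together exceed by [size GC] what [s3] allows, and [GC] contains the gap of
   [v0]. *)
have := leq_trans (leq_add s1 s2) s3.
by rewrite -addnA -[X in _ <= X]add0n leq_add2r leqNgt GC_gt0.
Qed.

End MergeCycle.

Lemma merge_cycleP P C :
  P != [::] -> sorted e P -> 1 < size C -> cycle e C ->
  multipartite_on (P ++ C) ->
  sorted e (merge_cycle P C) /\ perm_eq (merge_cycle P C) (P ++ C).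
Proof.
move=> P0 Pp C1 Cc mp; have [|] := boolP (has (sorted e) (candidates P C)).
  rewrite has_filter /merge_cycle; case fE: filter => [//|R l] _ /=.
  have : R \in R :: l by rewrite mem_head.
  by rewrite -fE mem_filter => /andP[-> /candidates_perm].
by move/(merge_cycle_contradiction P0 Pp C1 Cc mp).
Qed.

End Merge.

(** Serves the size bounds, which are about arbitrary inputs, including those on which the search
    fails. *)
Lemma merge_cycle_perm P C :
  merge_cycle P C = [::] \/ perm_eq (merge_cycle P C) (P ++ C).
Proof.
rewrite /merge_cycle; case fE: filter => [|R l] /=; [by left | right].
have : R \in R :: l by rewrite mem_head.
by rewrite -fE mem_filter => /andP[_ /candidates_perm].
Qed.

End Search.

(** * The auction algorithm *)

Section Auction.
Variables (T : eqType) (x0 : T) (w : T -> T -> nat) (U : seq T).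

(** An auction state consists of the people still without an object, the
    (person, object) pairs, and the list of all objects bid for so far; the
    price of an object is the number of bids for it. *)
Definition auction_state : Type := seq T * seq (T * T) * seq T.

(** An object maximising [w x y] minus its price, compared without truncated subtraction. *)
Definition best_object (log : seq T) (x : T) : T :=
  head x0 [seq y <- U | all (fun z =>
    w x z + count_mem y log <= w x y + count_mem z log) U].

Definition bid (st : auction_state) : auction_state :=
  let: (waiting, pairs, log) := st in
  if waiting is x :: others then
    let y := best_object log x in
    ([seq a.1 | a <- pairs & a.2 == y] ++ others,
     (x, y) :: [seq a <- pairs | a.2 != y], y :: log)
  else st.

Definition auction (k : nat) : seq (T * T) :=
  (iter k bid (U, [::], [::])).1.2.

Hypothesis U_uniq : uniq U.
Variable W : nat.
Hypothesis w_le : forall x y, w x y <= W.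

Definition bijection_on (B : seq (T * T)) :=
  perm_eq (unzip1 B) U && perm_eq (unzip2 B) U.

Lemma best_objectP log x : U != [::] ->
  best_object log x \in U /\ forall z, z \in U ->
    w x z + count_mem (best_object log x) log <= w x (best_object log x) + count_mem z log.
Proof.
move=> U0.
suff : has (fun y => all (fun z =>
    w x z + count_mem y log <= w x y + count_mem z log) U) U.
  rewrite has_filter /best_object; case fE: filter => [//|y l] _ /=.
  have : y \in y :: l by rewrite mem_head.
  by rewrite -fE mem_filter => /andP[/allP yP ->]; split.
move: U U0; elim=> // y s IH _; have [->|s0] := eqVneq s [::].
  by rewrite /= leqnn.
have /hasP[z zs /allP zP] := IH s0.
case: (leqP (w x y + count_mem z log) (w x z + count_mem y log)) => yz.
  by apply/hasP; exists z; [rewrite inE zs orbT | apply/allP => u; rewrite inE => /orP[/eqP -> //|/zP]].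
apply/hasP; exists y; first exact: mem_head.
apply/allP => u; rewrite inE => /orP[/eqP -> //|/zP]; lia.
Qed.

(** [inv_slack] is complementary slackness up to 1: no owner gains more than 1 by switching. By
    [inv_log] an object once bid for stays owned, so unowned objects have price 0. *)
Record auction_inv (st : auction_state) : Prop := {
  inv_people : perm_eq (st.1.1 ++ unzip1 st.1.2) U;
  inv_objects : uniq (unzip2 st.1.2);
  inv_objects_in : {subset unzip2 st.1.2 <= U};
  inv_log : {subset st.2 <= unzip2 st.1.2};
  inv_price : forall y, count_mem y st.2 <= W.+1;
  inv_slack : forall a z, a \in st.1.2 -> z \in U ->
    w a.1 z + count_mem a.2 st.2 <= w a.1 a.2 + count_mem z st.2 + 1 }.

Lemma bid_inv st : auction_inv st -> auction_inv (bid st).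
Proof.
case: st => [[[|x Q] B] log] //= [/= pU uB sB lB pr sl].
have U0 : U != [::] by apply: contraTneq pU => ->; rewrite perm_sym; apply/negP => /perm_size.
have [yU yP] := best_objectP log x U0; set y := best_object log x in yU yP *.
(* As [x] is waiting, some object [z] is unowned and has price 0. Preferring [y] to [z] means that
   [y] costs at most [W] before this bid. *)
have [z zU zB] : exists2 z, z \in U & z \notin unzip2 B.
  apply/hasP; apply: contraT; rewrite -all_predC => /allP sub.
  have /(uniq_leq_size U_uniq) : {subset U <= unzip2 B} by move=> z /sub /=; rewrite negbK.
  by rewrite -(perm_size pU) /= size_cat !size_map ltnNge leq_addl.
have z0 : count_mem z log = 0 by apply/count_memPn; apply: contra zB => /lB.
have yW : count_mem y log <= W by have := yP _ zU; rewrite z0; have := w_le x y; lia.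
split=> /=.
- apply: perm_trans pU; apply/permP => p.
  rewrite !count_cat /=.
  have : count p (unzip1 B) = count p [seq a.1 | a <- B & a.2 == y]
      + count p (unzip1 [seq a <- B | a.2 != y]).
    by elim: (B) => //= b B' ->; case: (b.2 == y) => /=; lia.
  by rewrite /unzip1 !count_cat => ->; lia.
- rewrite (subseq_uniq _ uB) ?map_subseq ?filter_subseq // andbT.
  by apply/mapP => -[a]; rewrite mem_filter => /andP[ay _] yE; rewrite yE eqxx in ay.
- move=> v; rewrite inE => /orP[/eqP -> //|/mapP[a]].
  by rewrite mem_filter => /andP[_ aB] ->; apply/sB/map_f.
- move=> v; rewrite !inE => /orP[-> //|/lB /mapP[a aB vE]].
  case: (eqVneq v y) => //= vy; apply/mapP; exists a => //.
  by rewrite mem_filter -vE vy.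
- by move=> v; rewrite eq_sym; case: eqVneq => [->|_] /=; rewrite ?pr.
- move=> a v; rewrite inE => /orP[/eqP -> /=|].
    by move=> vU; rewrite eqxx; have := yP _ vU; lia.
  rewrite mem_filter => /andP[ay aB] vU; have := sl _ _ aB vU.
  by rewrite [y == _]eq_sym (negbTE ay); lia.
Qed.

Lemma auction_state_inv k : auction_inv (iter k bid (U, [::], [::])).
Proof.
elim: k => [|k IH]; last exact: bid_inv.
by split; rewrite ?cats0.
Qed.

Lemma log_bound st : auction_inv st -> size st.2 <= size U * W.+1.
Proof.
move=> [_ _ sB lB pr _].
have : {subset st.2 <= U} by move=> y /lB /sB.
elim: {1 2}U {sB lB} st.2 pr => [|u V IH] l pr sub.
  by case: l sub {pr} => // y l /(_ y); rewrite mem_head => /(_ isT).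
rewrite -(count_predC (pred1 u)) mulSn leq_add // -size_filter IH //.
  move=> y; apply: leq_trans (pr y); rewrite count_filter.
  by apply: sub_count => z /andP[].
move=> y; rewrite mem_filter /= => /andP[yu /sub].
by rewrite inE (negbTE yu).
Qed.

(** Every round with a person waiting adds a bid, and [log_bound] limits the number of bids;
    afterwards everybody owns an object. *)
Lemma auction_bijection k : size U * W.+1 < k -> bijection_on (auction k).
Proof.
move=> kU; have := auction_state_inv k.
suff wait : (iter k bid (U, [::], [::])).1.1 = [::].
  move=> [pU uB sB _ _ _]; rewrite /bijection_on /auction; rewrite wait /= in pU.
  rewrite pU /=; apply: uniq_perm => //.
  have [|_ //] := uniq_min_size uB sB _.
  by rewrite !size_map -(perm_size pU) size_map.
move: kU; suff : (iter k bid (U, [::], [::])).1.1 = [::] \/ size (iter k bid (U, [::], [::])).2 = k.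
  by case=> // kE; rewrite -{1}kE ltnNge (log_bound (auction_state_inv k)).
elim: k => [|k]; first by right.
rewrite iterS; case: (iter k bid _) => [[[|x Q] B] log] /=; first by left.
by case=> // ->; right.
Qed.

(** Linear programming duality: summing [inv_slack] over the pairs of [B], the prices cancel because
    both assignments use every object once, and each person loses at most 1. *)
Lemma auction_near_optimal k B :
  size U * W.+1 < k -> bijection_on B ->
  \sum_(b <- B) w b.1 b.2 <= \sum_(a <- auction k) w a.1 a.2 + size U.
Proof.
move=> kU /andP[B1 B2]; have /andP[A1 A2] := auction_bijection kU.
have [_ _ _ _ _ sl] := auction_state_inv k.
set A := auction k in A1 A2 *; set log := (iter k _ _).2 in sl.
(* The object that [x] owns in [A]. *)
pose f x := nth x0 (unzip2 A) (index x (unzip1 A)).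
have fA a : a \in A -> f a.1 = a.2.
  move=> aA; have ia : index a A < size A by rewrite index_mem.
  have a1 : a.1 = nth x0 (unzip1 A) (index a A) by rewrite (nth_map a) // nth_index.
  rewrite /f a1 index_uniq ?size_map ?(perm_uniq A1) //.
  by rewrite (nth_map a) // nth_index.
have U_A (g : T -> nat) : \sum_(a <- A) g a.1 = \sum_(x <- U) g x.
  by rewrite -(perm_big _ A1) big_map.
have U_A2 (g : T -> nat) : \sum_(a <- A) g a.2 = \sum_(x <- U) g x.
  by rewrite -(perm_big _ A2) big_map.
have U_B (g : T -> nat) : \sum_(a <- B) g a.1 = \sum_(x <- U) g x.
  by rewrite -(perm_big _ B1) big_map.
have U_B2 (g : T -> nat) : \sum_(a <- B) g a.2 = \sum_(x <- U) g x.
  by rewrite -(perm_big _ B2) big_map.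
have sumA : \sum_(a <- A) w a.1 a.2 = \sum_(x <- U) w x (f x).
  by rewrite -U_A big_seq [RHS]big_seq; apply: eq_bigr => a /fA ->.
have priceA : \sum_(x <- U) count_mem (f x) log = \sum_(x <- U) count_mem x log.
  rewrite -U_A -U_A2 big_seq [RHS]big_seq; by apply: eq_bigr => a /fA ->.
rewrite sumA -(leq_add2r (\sum_(x <- U) count_mem (f x) log)).
rewrite -[X in _ + X <= _](U_B (fun x => count_mem (f x) log)) -big_split priceA.
rewrite -(U_B (fun x => w x (f x))) -(U_B2 (fun x => count_mem x log)) /=.
have -> : size U = \sum_(b <- B) 1.
  by rewrite sum1_size -(perm_size B1) size_map.
rewrite -!big_split /= big_seq [X in _ <= X]big_seq; apply: leq_sum => b bB.
have b1U : b.1 \in U by rewrite -(perm_mem B1) map_f.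
have b2U : b.2 \in U by rewrite -(perm_mem B2) map_f.
have /mapP[a aA ba] : b.1 \in unzip1 A by rewrite (perm_mem A1).
have := sl _ _ aA b2U; rewrite -ba (_ : a.2 = f b.1); first lia.
by rewrite ba fA.
Qed.

End Auction.

(** * Maximum-weight assignments and their orbits *)

Section Assignment.
Variables (n : nat) (E : seq (nat * nat)).

(** One missing arc outweighs all forward arcs together, and the factor [n.+2] in
    [weight] absorbs the additive error [n.+1] of the auction. The extra vertex
    is numbered [n]. *)
Definition base_weight (x y : nat) : nat :=
  if x == y then 0
  else if [|| x == n, y == n | (x, y) \in E] then n.+3
  else if (y, x) \in E then n.+2 else 0.

Definition weight (x y : nat) : nat := n.+2 * base_weight x y.

(** The number of rounds exceeds [size U * W.+1], where [W] is the bound [n.+2 * n.+3] on the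
    weights. *)
Definition assignment : seq (nat * nat) :=
  auction 0 weight (iota 0 n.+1) (n.+1 * (n.+2 * n.+3).+1).+1.

Definition successor (A : seq (nat * nat)) (x : nat) : nat :=
  head 0 [seq a.2 | a <- A & a.1 == x].

Definition orbit_step (A : seq (nat * nat)) (x : nat) (l : seq nat) : seq nat :=
  if successor A (head x l) \in l then l else successor A (head x l) :: l.

(** There are [n.+1] vertices, so [n] steps complete the orbit; once it has closed, further steps
    change nothing. *)
Definition orbit_of (A : seq (nat * nat)) (x : nat) : seq nat :=
  rev (iter n (orbit_step A x) [:: x]).

Definition absorb (F A : seq (nat * nat)) (P : seq nat) (x : nat) : seq nat :=
  if x \in P then P
  else merge_cycle 0 (fun y z => (y, z) \in F) P (orbit_of A x).

(** The orbit of the extra vertex [n], without [n], is the path of the factor; the other orbits are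
    its cycles. Below [n], the arcs [assignment ++ E] are those of [D']. *)
Definition ham_path : seq nat :=
  foldl (absorb (assignment ++ E) assignment)
        (behead (orbit_of assignment n)) (iota 0 n).

Definition forward_arcs (P : seq nat) : nat :=
  count (fun a => a \in E) (zip P (behead P)).

(** * Optimality of the assignment *)

Hypothesis E_lt : forall x y, (x, y) \in E -> x < n /\ y < n.

Definition feasible_arc (a : nat * nat) : bool :=
  (a.1 != a.2) && [|| a.1 == n, a.2 == n, a \in E | (a.2, a.1) \in E].

Lemma base_weight_feasible a : feasible_arc a ->
  base_weight a.1 a.2 = n.+2 + (a.1 == n) + (a.2 == n) + (a \in E).
Proof.
rewrite /feasible_arc /base_weight -surjective_pairing => /andP[/negbTE aN].
rewrite aN; have [E1|E1] := eqVneq a.1 n; have [E2|E2] := eqVneq a.2 n => //=.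
- by rewrite E1 E2 eqxx in aN.
- by case: (boolP (a \in E)) => [|_]; [case: a E1 E2 aN => x y /= -> _ _ /E_lt; lia | lia].
- by case: (boolP (a \in E)) => [|_]; [case: a E1 E2 aN => x y /= _ -> _ /E_lt; lia | lia].
- by case: (a \in E) => [|/= ->]; lia.
Qed.

Lemma base_weight_infeasible a : ~~ feasible_arc a -> base_weight a.1 a.2 = 0.
Proof.
rewrite /feasible_arc /base_weight -surjective_pairing.
by case: eqP => //= _; rewrite !negb_or => /and4P[/negbTE -> /negbTE -> /negbTE -> /negbTE ->].
Qed.

Lemma base_weight_le x y : base_weight x y <= n.+3.
Proof. by rewrite /base_weight; do !case: ifP. Qed.

Notation U := (iota 0 n.+1).

(** The surcharge for arcs at the extra vertex is the same for all bijections, so it does not affect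
    which one is best. *)
Lemma sum_end (B : seq (nat * nat)) : bijection_on U B ->
  \sum_(b <- B) ((b.1 == n) + (b.2 == n)) = 2.
Proof.
move=> /andP[B1 B2]; rewrite big_split /=.
rewrite -(big_map fst xpredT (fun x => (x == n) : nat)).
rewrite -(big_map snd xpredT (fun x => (x == n) : nat)).
rewrite (perm_big _ B1) (perm_big _ B2) /=.
suff -> : \sum_(x <- U) (x == n) = 1 by [].
by rewrite (bigD1_seq n) ?iota_uniq ?mem_iota ?leq0n ?ltnSn //= eqxx big1 // => i /negbTE ->.
Qed.

Lemma sum_feasible B : bijection_on U B -> all feasible_arc B ->
  \sum_(b <- B) base_weight b.1 b.2 = n.+1 * n.+2 + 2 + count (mem E) B.
Proof.
move=> bB /allP fB; rewrite big_seq.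
rewrite (eq_bigr (fun b => n.+2 + ((b.1 == n) + (b.2 == n)) + (b \in E))).
  rewrite -big_seq big_split /= big_split /= sum_end //.
  rewrite big_const_seq count_predT iter_addn_0.
  case/andP: bB => /perm_size; rewrite size_map size_iota => -> _.
  rewrite mulnC -sum1_count [in RHS]big_mkcond; congr (_ + _).
by move=> b /fB /base_weight_feasible ->; rewrite addnA.
Qed.

Hypothesis feasible : exists2 B, bijection_on U B & all feasible_arc B.

Lemma assignmentP :
  [/\ bijection_on U assignment, all feasible_arc assignment &
    forall B, bijection_on U B -> all feasible_arc B ->
      count (mem E) B <= count (mem E) assignment].
Proof.
have wle x y : weight x y <= n.+2 * n.+3 by rewrite leq_mul2l base_weight_le orbT.
have kU : size U * (n.+2 * n.+3).+1 < (n.+1 * (n.+2 * n.+3).+1).+1 by rewrite size_iota.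
have bA : bijection_on U assignment.
  exact: (auction_bijection 0 (iota_uniq _ _) wle kU).
have opt B : bijection_on U B -> \sum_(b <- B) base_weight b.1 b.2 <=
    \sum_(a <- assignment) base_weight a.1 a.2.
  move=> bB; have := auction_near_optimal 0 (iota_uniq _ _) wle kU bB.
  rewrite /weight -!big_distrr /= size_iota -/weight -/assignment.
  move=> h; rewrite -ltnS -(ltn_pmul2l (ltn0Sn n.+1)).
  by apply: leq_ltn_trans h _; rewrite [X in _ < X]mulnS addnC ltn_add2r.
have fA : all feasible_arc assignment.
  apply: contraT => /allPn[a aA aN].
  have [B bB fB] := feasible.
  have := opt B bB; rewrite sum_feasible // (big_rem a) //= base_weight_infeasible //.
  (* With one infeasible arc the total is at most [n * n.+3], which is less than the
     [n.+1 * n.+2 + 2] that every feasible bijection reaches. *)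
  move=> h; have : \sum_(b <- rem a assignment) base_weight b.1 b.2 <= n * n.+3.
    apply: (@leq_trans (\sum_(b <- rem a assignment) n.+3)).
      by apply: leq_sum => b _; apply: base_weight_le.
    rewrite big_const_seq count_predT iter_addn_0 size_rem //.
    case/andP: bA => /perm_size; rewrite size_map size_iota => -> _.
    by rewrite mulnC.
  by move: h; set s := \sum_(_ <- _) _; nia.
split=> // B bB fB; have := opt B bB.
by rewrite !sum_feasible // leq_add2l.
Qed.

End Assignment.

Lemma uniq_map_inj (T1 T2 : eqType) (f : T1 -> T2) s :
  uniq (map f s) -> {in s &, injective f}.
Proof.
elim: s => //= x s IH /andP[xN us] y z; rewrite !inE.
move=> /orP[/eqP-> | ys] /orP[/eqP-> | zs] // fE; last exact: IH.
- by rewrite fE map_f in xN.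
- by rewrite -fE map_f in xN.
Qed.

(** * Orbits of a bijection given by its arcs *)

Section Orbits.
Variables (n : nat) (A : seq (nat * nat)).
Hypothesis A_bij : bijection_on (iota 0 n.+1) A.
Notation next_vertex := (successor A).

Lemma successorE a : a \in A -> next_vertex a.1 = a.2.
Proof.
case/andP: A_bij => /perm_uniq u1 _ aA.
rewrite iota_uniq in u1; rewrite /successor.
have : a \in [seq b <- A | b.1 == a.1] by rewrite mem_filter eqxx.
case fE: filter => [//|b l] _ /=.
have : b \in b :: l by rewrite mem_head.
rewrite -fE mem_filter => /andP[/eqP b1 bA].
by rewrite (uniq_map_inj u1 bA aA b1).
Qed.

Lemma successor_arc x : x <= n -> (x, next_vertex x) \in A.
Proof.
case/andP: A_bij => /perm_mem A1 _ xn.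
have /mapP[a aA ->] : x \in unzip1 A by rewrite A1 mem_iota.
by rewrite successorE // -surjective_pairing.
Qed.

Lemma successor_le x : x <= n -> next_vertex x <= n.
Proof.
case/andP: A_bij => _ /perm_mem A2 /successor_arc xA.
have : next_vertex x \in unzip2 A by apply/mapP; exists (x, next_vertex x).
by rewrite A2 mem_iota.
Qed.

Lemma successor_inj x y : x <= n -> y <= n ->
  next_vertex x = next_vertex y -> x = y.
Proof.
case/andP: A_bij => _ /perm_uniq u2 /successor_arc xA /successor_arc yA xy.
rewrite iota_uniq in u2.
by have := uniq_map_inj u2 xA yA xy => -[].
Qed.

(** The list grows until the next vertex repeats or all [n.+1] vertices are present; either way the
    successor of the newest vertex is in the list. By injectivity it can only be [x]. *)
Lemma orbit_ofP x : x <= n -> exists p,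
  [/\ orbit_of n A x = x :: p, uniq (x :: p), all (fun y => y <= n) (x :: p)
    & cycle (frel next_vertex) (x :: p)].
Proof.
move=> xn; set f := next_vertex.
(* The default [n.+1] makes [last n.+1 l = x] exclude the empty list. *)
pose inv l := [/\ uniq l, all (fun y => y <= n) l, last n.+1 l = x &
  sorted (fun a b => f b == a) l].
have orb k : inv (iter k (orbit_step A x) [:: x]) /\
    (f (head x (iter k (orbit_step A x) [:: x])) \in iter k (orbit_step A x) [:: x]
    \/ size (iter k (orbit_step A x) [:: x]) = k.+1).
  elim: k => [|k [[ul ln lx sl] IH]]; first by split; [rewrite /inv /= xn | right].
  rewrite iterS; set l := iter k _ _ in ul ln lx sl IH *.
  rewrite /orbit_step -/f; case: ifP => fl; first by split=> //; left; rewrite fl.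
  case: l ul ln lx sl IH fl => [|y l] ul ln lx sl IH fl.
    by move: xn; rewrite -lx /= ltnn.
  have yn : y <= n by case/andP: ln.
  split; last by right; case: IH => [|/= ->]; rewrite ?fl.
  split; [by rewrite cons_uniq fl | | by [] | by rewrite /= eqxx].
  by rewrite /= in ln *; rewrite successor_le.
rewrite /orbit_of; have [] := orb n.
set l := iter n _ _ => -[ul /allP ln lx sl] fl.
have lU : {subset l <= iota 0 n.+1} by move=> y /ln; rewrite mem_iota.
have {}fl : f (head x l) \in l.
  case: fl => // szl; have [|_ ->] := uniq_min_size ul lU _; first by rewrite size_iota szl.
  rewrite mem_iota /= ltnS successor_le //; case: (l) ln => [|y l'] /= ln; first exact: xn.
  by apply: ln; rewrite mem_head.
case: l => [|y l] in ul ln lx sl lU fl *; first by move: xn; rewrite -lx /= ltnn.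
have yn : y <= n by apply: ln; rewrite mem_head.
(* If [f y] were not the oldest vertex, it would also be the successor of an older vertex [z] in the
   list, and [z = y] would be repeated. *)
have fyx : f y = x.
  have [L1 [L2 lE]] : exists L1 L2, y :: l = L1 ++ f y :: L2.
    by case/splitPr: fl => L1 L2; exists L1, L2.
  case: L2 lE => [|z L2] lE; first by rewrite -lx lE last_cat.
  have zn : z <= n by apply: ln; rewrite lE mem_cat !inE eqxx !orbT.
  have fz : f z = f y.
    by move: sl; rewrite lE (sorted_cat _ 0) => /and3P[_ /= /andP[/eqP]].
  have zy : z = y by apply: successor_inj.
  have : uniq (y :: l) by [].
  rewrite lE zy; case: L1 lE => [|u L1] [yE _] /=; rewrite -yE.
    by rewrite inE eqxx.
  by rewrite mem_cat !inE eqxx !orbT.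
move: lx sl ul ln; rewrite -[y :: l]revK; set r := rev (y :: l).
rewrite -[y in f y](_ : last n.+1 r = y) in fyx; last by rewrite /r rev_cons last_rcons.
case: r fyx => [|x' p] fyx; first by move=> /= xE; move: xn; rewrite -xE ltnn.
rewrite rev_cons last_rcons => xE; rewrite {x'}xE in fyx *.
rewrite -rev_cons rev_sorted rev_uniq => sl ul ln.
exists p; split; rewrite ?revK //.
  by apply/allP => z zp; apply: ln; rewrite mem_rev.
rewrite /= rcons_path; apply/andP; split; [exact: sl | exact/eqP].
Qed.

End Orbits.

(** * The Hamilton path *)

Lemma sorted_zip (T : Type) (e : rel T) s :
  sorted e s = all (fun a => e a.1 a.2) (zip s (behead s)).
Proof. by case: s => //= x s; elim: s x => //= y s IH x; rewrite IH. Qed.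

Lemma mem_zip (T1 T2 : eqType) (s : seq T1) (t : seq T2) a :
  a \in zip s t -> a.1 \in s /\ a.2 \in t.
Proof.
elim: s t => [|x s IH] [|y t] //=; rewrite inE => /orP[/eqP ->|/IH[a1 a2]].
  by rewrite /= !inE !eqxx.
by rewrite !inE a1 a2 !orbT.
Qed.

Section HamPath.
Variables (n : nat) (E : seq (nat * nat)) (K : eqType) (key : nat -> K).
Hypothesis E_lt : forall x y, (x, y) \in E -> x < n /\ y < n.
Hypothesis E_key : forall x y, x < n -> y < n ->
  ((x, y) \in E) || ((y, x) \in E) = (key x != key y).
Hypothesis feasible :
  exists2 B, bijection_on (iota 0 n.+1) B & all (feasible_arc n E) B.

Notation A := (assignment n E).
Notation f := (successor A).
Notation D' := (fun x y => (x, y) \in A ++ E).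

Let A_bij : bijection_on (iota 0 n.+1) A.
Proof. by case: (assignmentP E_lt feasible). Qed.

Lemma assignment_feasible a : a \in A -> feasible_arc n E a.
Proof. by case: (assignmentP E_lt feasible) => _ /allP fA _ /fA. Qed.

Lemma successor_neq x : x <= n -> f x != x.
Proof.
by move=> /(successor_arc A_bij)/assignment_feasible/andP[/= xN _]; rewrite eq_sym.
Qed.

(** Below [n], a feasible arc joins vertices already adjacent in [E], so the partite sets stay the
    same. *)
Lemma augmented_multipartite s :
  {subset s <= gtn n} -> multipartite_on D' key s.
Proof.
move=> sn x y /sn xn /sn yn; rewrite !unfold_in /= in xn yn; rewrite -E_key // !mem_cat.
have sub u v : u < n -> v < n -> (u, v) \in A -> ((u, v) \in E) || ((v, u) \in E).
  move=> un vn /assignment_feasible/andP[_ /=].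
  by rewrite !ltn_eqF.
apply/idP/idP; last by case/orP=> ->; rewrite !orbT.
case/orP=> /orP[/sub|->]; rewrite ?orbT //; first exact.
by move=> /(_ yn xn); rewrite orbC.
Qed.

(** Up to [n], the list is a union of orbits of [f]. *)
Definition saturated (s : seq nat) :=
  forall y, y <= n -> (y \in s) = (f y \in s).

Lemma orbit_saturated x : x <= n -> saturated (orbit_of n A x).
Proof.
move=> xn; have [p [-> up /allP pn cp]] := orbit_ofP A_bij xn.
have fnext y : y \in x :: p -> f y = next (x :: p) y.
  by move=> yp; have /eqP := next_cycle cp yp.
move=> y yn; apply/idP/idP => [yp|fyp]; first by rewrite fnext // mem_next.
have py : prev (x :: p) (f y) \in x :: p by rewrite mem_prev.
have : f (prev (x :: p) (f y)) = f y by rewrite fnext // next_prev.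
by move/(successor_inj A_bij (pn _ py) yn) => <-.
Qed.

Record path_inv (P : seq nat) : Prop := {
  path_inv_nil : P != [::];
  path_inv_sorted : sorted D' P;
  path_inv_uniq : uniq P;
  path_inv_lt : {subset P <= gtn n};
  path_inv_saturated : saturated (n :: P) }.

Lemma frel_assignment x s : all (fun y => y <= n) (x :: s) ->
  path (frel f) x s -> path D' x s.
Proof.
elim: s x => //= y s IH x /and3P[xn yn sn] /andP[/eqP fx ys].
apply/andP; split; last by apply: IH => //=; rewrite yn.
by rewrite mem_cat -fx (successor_arc A_bij xn).
Qed.

Lemma first_path_inv : path_inv (behead (orbit_of n A n)).
Proof.
have sat := orbit_saturated (leqnn n).
have [p [pE /= /andP[np up] pn cp]] := orbit_ofP A_bij (leqnn n).
rewrite pE /= in sat pn cp *.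
split=> //.
- by case: (p) cp => //=; rewrite (negbTE (successor_neq (leqnn n))).
- have : path D' n (rcons p n).
    by apply: frel_assignment => //=; rewrite all_rcons /= leqnn; case/andP: pn.
  by rewrite rcons_path => /andP[/path_sorted].
- move=> y yp; have /allP/(_ y yp) : all (fun y => y <= n) p by case/andP: pn.
  by rewrite unfold_in /= ltn_neqAle => ->; rewrite andbT; apply: contraNneq np => <-.
Qed.

Lemma absorb_inv P x : x < n -> path_inv P ->
  path_inv (absorb n (A ++ E) A P x) /\
  {subset x :: P <= absorb n (A ++ E) A P x}.
Proof.
move=> xn iP; rewrite /absorb; case: ifP => xP.
  by split=> // y; rewrite inE => /orP[/eqP ->|].
case: (iP) => P0 Ps uP Pn sP.
have sat := orbit_saturated (ltnW xn).
have [p [pE up /allP pn cp]] := orbit_ofP A_bij (ltnW xn).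
rewrite pE in sat *.
have xN : x \notin n :: P by rewrite inE xP orbF ltn_eqF.
(* An orbit that starts outside [n :: P] never enters it, because [n :: P] is saturated. *)
have disj : {in x :: p, forall y, y \notin n :: P}.
  have : path (frel f) x p by move: cp; rewrite /= rcons_path => /andP[].
  elim: p x xN {xn xP pE up cp sat} pn => [|z p IH] x xN pn.
    by move=> _ y; rewrite inE => /eqP ->.
  move=> /= /andP[/eqP fx zp] y; rewrite inE => /orP[/eqP -> //|yp].
  apply: (IH z) yp => //; last by move=> u up; apply: pn; rewrite inE up orbT.
  by rewrite -fx -sP // pn // mem_head.
have pn' : {subset x :: p <= gtn n}.
  move=> y yp; have := disj y yp; rewrite inE negb_or => /andP[yn _].
  by rewrite unfold_in /= ltn_neqAle yn pn.
have p1 : 1 < size (x :: p).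
  by case: (p) cp => //=; rewrite (negbTE (successor_neq (ltnW xn))).
have cD : cycle D' (x :: p).
  apply: frel_assignment => //=; rewrite all_rcons /= (ltnW xn) /=.
  by apply/allP => y yp; apply: pn; rewrite inE yp orbT.
have mp : multipartite_on D' key (P ++ x :: p).
  apply: augmented_multipartite => y; rewrite mem_cat => /orP[/Pn //|/pn' //].
have [Rs Rp] := merge_cycleP 0 P0 Ps p1 cD mp.
split; last by move=> y; rewrite (perm_mem Rp) mem_cat !inE => /orP[->|->]; rewrite ?orbT.
split=> //.
- by apply: contraNneq P0 => RE; move: Rp; rewrite RE perm_sym => /perm_size/eqP; rewrite size_cat addn_eq0 size_eq0 => /andP[].
- rewrite (perm_uniq Rp) cat_uniq uP up andbT /= -[_ || _]/(has (mem P) (x :: p)).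
  by apply/hasPn => y /disj; rewrite inE negb_or => /andP[].
- by move=> y; rewrite (perm_mem Rp) mem_cat => /orP[/Pn //|/pn' //].
have inR z : (z \in n :: merge_cycle 0 D' P (x :: p)) = (z \in n :: P) || (z \in x :: p).
  by rewrite inE (perm_mem Rp) mem_cat [in RHS]inE -orbA.
by move=> y yn; rewrite !inR (sP y yn) (sat y yn).
Qed.

Lemma ham_path_inv : path_inv (ham_path n E) /\ perm_eq (ham_path n E) (iota 0 n).
Proof.
have foldP l P : {subset l <= gtn n} -> path_inv P ->
    path_inv (foldl (absorb n (A ++ E) A) P l) /\
    {subset P ++ l <= foldl (absorb n (A ++ E) A) P l}.
  elim: l P => [|x l IH] P ln iP; first by split=> // y; rewrite cats0.
  have [iP' sub] := absorb_inv (ln x (mem_head _ _)) iP.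
  have [iR sub'] := IH _ (fun y yl => ln y (mem_behead (s := x :: l) yl)) iP'.
  split=> // y; rewrite mem_cat inE orbCA orbA => /orP[yx|yl]; apply: sub'; rewrite mem_cat.
    by rewrite sub // inE.
  by rewrite yl orbT.
have ltI : {subset iota 0 n <= gtn n} by move=> y; rewrite mem_iota.
have [iR sub] := foldP _ _ ltI first_path_inv; split=> //.
apply: uniq_perm; rewrite ?iota_uniq ?(path_inv_uniq iR) // => y.
apply/idP/idP => [/(path_inv_lt iR)|yn]; first by rewrite mem_iota.
by apply: sub; rewrite mem_cat yn orbT.
Qed.

(** Of the [n.+1] arcs of the assignment, two are at the extra vertex and [skew] collects the others
    outside [E]. The path has [n.-1] arcs, and those outside [E] all belong to [skew]; so at least
    as many of its arcs are in [E]. *)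
Lemma ham_path_optimal B :
  bijection_on (iota 0 n.+1) B -> all (feasible_arc n E) B ->
  count (mem E) B <= forward_arcs E (ham_path n E).
Proof.
move=> bB fB; have [bA fA opt] := assignmentP E_lt feasible.
apply: leq_trans (opt B bB fB) _.
have [[R0 Rs Ru Rn _] Rp] := ham_path_inv.
set R := ham_path n E in R0 Rs Ru Rn Rp *; set Z := zip R (behead R).
have szR : size R = n by rewrite (perm_size Rp) size_iota.
have szZ : size Z = n.-1 by rewrite size_zip size_behead szR; apply/minn_idPr/leq_pred.
pose skew := [seq a <- A | [&& a \notin E, a.1 != n & a.2 != n]].
have Z_in a : a \in Z -> [/\ a \in A ++ E, a.1 < n & a.2 < n].
  move=> aZ; have [a1 /mem_behead a2] := mem_zip aZ; split; [|exact: Rn|exact: Rn].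
  by move: Rs; rewrite sorted_zip => /allP/(_ a aZ); rewrite -surjective_pairing.
have skewZ : count (predC (mem E)) Z <= size skew.
  rewrite -size_filter; apply: uniq_leq_size.
    apply/filter_uniq/(@map_uniq _ _ snd); rewrite -/(unzip2 _) unzip2_zip.
      by case: (R) Ru => //= x r /andP[].
    by rewrite size_behead leq_pred.
  move=> a; rewrite !mem_filter /= => /andP[aE /Z_in[]].
  by rewrite mem_cat (negbTE aE) orbF => -> /ltn_eqF -> /ltn_eqF ->.
have skewA : size skew + count (mem E) A + 2 = n.+1.
  case/andP: (bA) => /perm_size; rewrite size_map size_iota => <- _.
  have cnt p : count p A = \sum_(a <- A) p a.
    by rewrite -sum1_count big_mkcond; apply: eq_bigr => a _; case: (p a).
  rewrite -(sum_end bA) size_filter !cnt -sum1_size -!big_split /=.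
  rewrite big_seq [RHS]big_seq; apply: eq_bigr => -[x y] /assignment_feasible/andP[/= xy _].
  have [xE|xN] := eqVneq x n; have [yE|yN] := eqVneq y n => /=.
  - by rewrite xE yE eqxx in xy.
  - by case: (boolP (_ \in E)) => // /E_lt; rewrite xE ltnn => -[].
  - by case: (boolP (_ \in E)) => // /E_lt; rewrite yE ltnn => -[].
  - by case: (_ \in E).
have cZ : count (mem E) Z + count (predC (mem E)) Z = n.-1 by rewrite count_predC.
have -> : forward_arcs E R = count (mem E) Z by apply: eq_count.
move: cZ skewZ skewA; clear; lia.
Qed.

End HamPath.

(** * Transfer to digraphs on a finite type *)

Definition arcs_of (M : seq (seq bool)) : seq (nat * nat) :=
  [seq a <- [seq (x, y) | x <- iota 0 (size M), y <- iota 0 (size M)]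
  | nth false (nth [::] M a.1) a.2].

Definition solve (M : seq (seq bool)) : nat * seq nat :=
  (forward_arcs (arcs_of M) (ham_path (size M) (arcs_of M)),
   ham_path (size M) (arcs_of M)).

Lemma cycle_zip (T : Type) (e : rel T) c :
  cycle e c = all (fun a => e a.1 a.2) (zip c (rot 1 c)).
Proof.
case: c => // x p; rewrite rot1_cons /=.
by elim: p {1 3}x => [|z p IH] y //=; rewrite IH.
Qed.

(** In a sorted list, equal values at [i] and [j] fill the whole stretch between them. *)
Lemma count_run (K : seq nat) i j : sorted leq K -> i <= j -> j < size K ->
  nth 0 K i = nth 0 K j -> j - i < count_mem (nth 0 K i) K.
Proof.
move=> sK ij jK Kij.
have mid k : i <= k -> k <= j -> nth 0 K k = nth 0 K i.
  move=> ik kj; apply/eqP; rewrite eqn_leq {1}Kij.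
  by rewrite !(sorted_leq_nth leq_trans leqnn) // ?inE; move: ik kj jK; clear; lia.
rewrite -{2}(cat_take_drop i K) count_cat; apply: leq_trans (leq_addl _ _).
rewrite -(cat_take_drop (j - i).+1 (drop i K)) count_cat; apply: leq_trans (leq_addr _ _).
have sz : size (take (j - i).+1 (drop i K)) = (j - i).+1.
  by rewrite size_takel // size_drop; move: ij jK; clear; lia.
rewrite -[X in X <= _]sz; apply/eq_leq/esym/eqP; rewrite -all_count; apply/(all_nthP 0) => k; rewrite sz => kj /=.
rewrite nth_take // nth_drop mid ?leq_addr //; move: kj ij; clear; lia.
Qed.

Lemma zip_map2 (T1 T2 S1 S2 : Type) (f : T1 -> S1) (g : T2 -> S2) s t :
  zip (map f s) (map g t) = [seq (f a.1, g a.2) | a <- zip s t].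
Proof. by elim: s t => [|x s IH] [|y t] //=; rewrite IH. Qed.

Lemma count_zip_cat (T1 T2 : Type) (a : pred (T1 * T2)) s t u :
  count a (zip s t) <= count a (zip s (t ++ u)).
Proof. by elim: s t => [|x s IH] [|y t] //=; rewrite leq_add2l. Qed.

Section Transfer.
Variables (p : nat) (V : finType) (D : rel V) (part : V -> 'I_p).
Hypothesis smd : semicomplete_multipartite D part.
Hypothesis balanced : 2 * (\max_(i < p) #|partite_set part i|)
  <= (\sum_(i < p) #|partite_set part i|) + 1.
Variable x0 : V.

Notation n := #|V|.
Notation vtx := (nth x0 (enum V)).
Definition rank (x : V) : nat := enum_rank x.

Definition adjacency_matrix : seq (seq bool) :=
  [seq [seq D x y | y <- enum V] | x <- enum V].
Notation M := adjacency_matrix.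
Notation E := (arcs_of M).

Lemma size_matrix : size M = n.
Proof. by rewrite size_map -cardE. Qed.

Lemma rank_lt x : rank x < n.
Proof. exact: ltn_ord. Qed.

Lemma rankK : cancel rank vtx.
Proof. exact: nth_enum_rank. Qed.

Lemma vtxK i : i < n -> rank (vtx i) = i.
Proof.
move=> i_n; rewrite /rank -[i]/(val (Ordinal i_n)) -enum_val_nth.
by rewrite enum_valK.
Qed.

Lemma mem_arcs x y : (x, y) \in E = [&& x < n, y < n & D (vtx x) (vtx y)].
Proof.
have entry : x < n -> y < n -> nth false (nth [::] M x) y = D (vtx x) (vtx y).
  by move=> xn yn; rewrite (nth_map x0) -?cardE // (nth_map x0) -?cardE.
rewrite mem_filter /= size_matrix; apply/andP/and3P => [[d]|[xn yn d]].
  case/allpairsP=> [[i j] [/=]]; rewrite !mem_iota /= => xn yn [xE yE].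
  by rewrite -xE in xn; rewrite -yE in yn; rewrite -entry.
split; first by rewrite entry.
by apply/allpairsP; exists (x, y); rewrite !mem_iota.
Qed.

Lemma mem_arcs_rank x y : (rank x, rank y) \in E = D x y.
Proof. by rewrite mem_arcs !rank_lt !rankK. Qed.

Lemma arcs_lt x y : (x, y) \in E -> x < n /\ y < n.
Proof. by rewrite mem_arcs => /and3P[]. Qed.

Lemma arcs_part x y : x < n -> y < n ->
  ((x, y) \in E) || ((y, x) \in E) = (part (vtx x) != part (vtx y)).
Proof. by case: smd => _ _ <- xn yn; rewrite !mem_arcs xn yn. Qed.

Lemma feasible_rank x y : underlying D x y -> feasible_arc n E (rank x, rank y).
Proof.
move=> xy; rewrite /feasible_arc /= !mem_arcs_rank -[D x y || _]/(underlying D x y) xy.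
rewrite !orbT andbT; apply: contraTneq xy => /(congr1 vtx); rewrite !rankK => ->.
by case: smd => _ _ ->; rewrite eqxx.
Qed.

(** * Feasible bijections *)

Definition closed_arcs (CS : seq (seq nat)) := flatten [seq zip c (rot 1 c) | c <- CS].

Lemma closed_arcs_bij CS : perm_eq (flatten CS) (iota 0 n.+1) ->
  bijection_on (iota 0 n.+1) (closed_arcs CS).
Proof.
move=> pCS; rewrite /bijection_on; apply/andP; split.
  rewrite /unzip1 map_flatten -map_comp (eq_map (g := id)) ?map_id // => c /=.
  by rewrite -/(unzip1 _) unzip1_zip ?size_rot.
apply: perm_trans pCS; rewrite /unzip2 map_flatten -map_comp.
rewrite (eq_map (g := rot 1)) => [|c /=]; last by rewrite -/(unzip2 _) unzip2_zip ?size_rot.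
by elim: CS => //= c CS IH; apply: perm_cat => //; rewrite perm_rot.
Qed.

Lemma n_gt1 : 1 < n.
Proof.
case: smd => p2 /(_ _)/set0Pn ne _.
have [x] := ne (Ordinal (ltnW p2)); have [y] := ne (Ordinal p2).
rewrite !inE => /eqP yi /eqP xi.
have xy : x != y by apply: contraTneq isT => xy; move: xi; rewrite xy yi.
by have := subset_leq_card (subsetT [set x; y]); rewrite cards2 xy cardsT.
Qed.

Lemma part_count i : 2 * #|partite_set part i| <= n.+1.
Proof.
have -> : n = \sum_(i < p) #|partite_set part i|.
  rewrite -sum1_card (partition_big part xpredT) //=.
  by apply: eq_bigr => j _; rewrite -sum1_card; apply: eq_bigl => x; rewrite inE.
rewrite -[X in _ <= X]addn1; apply: leq_trans balanced; rewrite leq_mul2l /=.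
exact: (leq_bigmax i).
Qed.

(* After sorting by partite set, a cyclic shift by half the length moves every
   vertex out of its partite set. *)
Lemma feasible_exists :
  exists2 B, bijection_on (iota 0 n.+1) B & all (feasible_arc n E) B.
Proof.
pose key i := if i == n then p else part (vtx i) : nat.
pose L := sort (relpre key leq) (iota 0 n.+1).
have pL : perm_eq L (iota 0 n.+1) by rewrite perm_sort.
have szL : size L = n.+1 by rewrite (perm_size pL) size_iota.
(* By the balance condition every class has at most [h] elements. A cyclic shift by [h] moves
   positions by [h] or by [n.+1 - h], which is at least [h]. *)
pose h := n.+1 %/ 2.
have h_gt0 : 0 < h by rewrite /h divn_gt0 // ltnS ltnW // n_gt1.
have hn : h + h <= n.+1 by rewrite addnn -muln2 leq_divM.
have hn' : n.+1 - h >= h by rewrite leq_subRL // (leq_trans (leq_addr _ _) hn).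
have kcount c : count_mem c (map key L) <= h.
  have /permP -> : perm_eq (map key L) (map key (iota 0 n.+1)) by apply: perm_map.
  have key_n : key n = p by rewrite /key eqxx.
  have keyE : map key (iota 0 n) = [seq part x : nat | x <- enum V].
    rewrite -[enum V](mkseq_nth x0) /mkseq -cardE -map_comp.
    by apply/eq_in_map => i; rewrite mem_iota /= /key => /ltn_eqF ->.
  rewrite -addn1 iotaD map_cat count_cat /= add0n key_n addn0 keyE count_map.
  have [->|cp] := eqVneq c p.
    rewrite addn1 (@eq_count _ _ pred0) ?count_pred0 // => x /=.
    by rewrite ltn_eqF.
  rewrite addn0.
  have [|] := boolP (has (preim (fun x => part x : nat) (pred1 c)) (enum V)).
    case/hasP=> x _ /= /eqP <-; rewrite leq_divRL // mulnC.
    apply: leq_trans (part_count (part x)); rewrite leq_mul2l /= -sum1_count big_enum_cond.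
    by rewrite -sum1_card; apply/eq_leq/eq_bigl => y; rewrite !inE /= -val_eqE.
  by rewrite has_count -eqn0Ngt => /eqP ->.
have sK : sorted leq (map key L).
  by rewrite sorted_map; apply: sort_sorted => x y; apply: leq_total.
exists (zip L (rot h L)).
  by rewrite /bijection_on unzip1_zip ?unzip2_zip ?size_rot // perm_rot pL.
apply/(all_nthP (0, 0)) => i; rewrite size_zip size_rot minnn szL => iN.
rewrite nth_zip ?size_rot //.
set x := nth 0 L i; set y := nth 0 _ i.
have xy : key x != key y.
  have keyE j : j < n.+1 -> key (nth 0 L j) = nth 0 (map key L) j.
    by move=> jn; rewrite (nth_map 0) ?szL.
  have far j k : j <= k -> k < n.+1 -> h <= k - j ->
      key (nth 0 L j) != key (nth 0 L k).
    move=> jk kn hjk; rewrite !keyE ?(leq_ltn_trans jk kn) //.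
    apply/eqP => jkE; have := count_run sK jk; rewrite size_map szL => /(_ kn jkE).
    by move/leq_trans/(_ (kcount _)); rewrite ltnNge hjk.
  have yE : y = nth 0 L (if i + h < n.+1 then i + h else i + h - n.+1).
    rewrite /y /rot nth_cat size_drop szL nth_drop addnC.
    case: ltnP => ih; case: ltnP => ih' //; try by move: ih ih'; clear; lia.
    rewrite nth_take; first by congr (nth _ _ _); move: hn iN ih'; clear; lia.
    by move: hn iN ih'; clear; lia.
  rewrite yE; case: ltnP => ih; first by apply: far => //; move: hn; clear; lia.
  by rewrite eq_sym; apply: far => //; move: hn iN ih; clear; lia.
have lt z : z \in L -> z != n -> z < n.
  by rewrite (perm_mem pL) mem_iota /= ltnS leq_eqVlt => /orP[->|].
have xL : x \in L by rewrite mem_nth // szL.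
have yL : y \in L by rewrite -(mem_rot h) mem_nth // size_rot szL.
rewrite /feasible_arc /=; apply/andP; split; first by apply: contraNneq xy => ->.
have [//|xn] := eqVneq x n; have [//|yn] := eqVneq y n.
rewrite arcs_part ?lt //=; move: xy; rewrite /key (negbTE xn) (negbTE yn).
by apply: contraNN => /eqP ->.
Qed.

(** * Costs of factors and of Hamilton paths *)

Lemma pc_costE F : pc_cost (hat_cost D) F =
  count (mem E) [seq (rank a.1, rank a.2) | a <- pc_arcs F].
Proof.
rewrite /pc_cost count_map -sum1_count [RHS]big_mkcond; apply: eq_bigr => a _.
by rewrite /hat_cost /= mem_arcs_rank.
Qed.

(** Closing the path of the factor through the extra vertex turns the factor into a feasible
    bijection that uses at least as many arcs of [E]; [ham_path_optimal] applies to it. *)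
Lemma factor_cost_le F : one_path_cycle_factor (hat D) F ->
  pc_cost (hat_cost D) F <= forward_arcs E (ham_path n E).
Proof.
case: F => Q CS /and5P[/= Q0 Qp /allP CSc Fu /forallP Fall].
have hatU x y : hat D x y -> underlying D x y.
  by rewrite /hat /underlying /= => /orP[->//|/andP[->]]; rewrite orbT.
pose CS' := (n :: map rank Q) :: map (map rank) CS.
have flatE : flatten CS' = n :: map rank (Q ++ flatten CS).
  by rewrite /CS' /= map_cat map_flatten.
have B_bij : bijection_on (iota 0 n.+1) (closed_arcs CS').
  apply: closed_arcs_bij; apply: uniq_perm; rewrite ?iota_uniq //.
    rewrite flatE /= (map_inj_uniq (can_inj rankK)) Fu andbT.
    by apply/mapP => -[x _ nx]; have := rank_lt x; rewrite -nx ltnn.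
  move=> y; rewrite flatE inE mem_iota /= ltnS leq_eqVlt; case: eqVneq => //= _.
  by apply/mapP/idP => [[x _ ->]|yn]; [exact: rank_lt | exists (vtx y); rewrite ?vtxK].
have feas_n x : feasible_arc n E (n, rank x) && feasible_arc n E (rank x, n).
  by rewrite /feasible_arc /= eqxx !orbT !andbT eq_sym andbb neq_ltn rank_lt.
have B_feas : all (feasible_arc n E) (closed_arcs CS').
  apply/allP => a /flattenP[_ /mapP[c cCS ->] ac].
  suff : cycle (fun x y => feasible_arc n E (x, y)) c.
    by rewrite cycle_zip => /allP/(_ a ac); rewrite -surjective_pairing.
  move: a ac => _ _.
  move: cCS; rewrite inE => /orP[/eqP ->|/mapP[c' /CSc/andP[_ cc] ->]]; last first.
    by rewrite cycle_map; apply: sub_cycle cc => x y /hatU/feasible_rank.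
  case: (Q) Q0 Qp => // x Q' _ /= xQ'; rewrite rcons_path last_map path_map.
  case/andP: (feas_n x) => -> _; case/andP: (feas_n (last x Q')) => _ ->.
  by rewrite andbT; apply: sub_path xQ' => y z /hatU/feasible_rank.
apply: leq_trans (ham_path_optimal arcs_lt arcs_part feasible_exists B_bij B_feas).
rewrite pc_costE /pc_arcs /closed_arcs /= map_cat !count_cat leq_add //.
  case: (Q) Q0 => // x Q' _; rewrite rot1_cons /path_arcs /= -zip_map2 -cats1.
  by apply: leq_trans (leq_addl _ _); apply: (count_zip_cat _ (rank x :: _)).
rewrite map_flatten -!map_comp; apply/eq_leq; congr (count _ (flatten _)).
by apply: eq_map => c /=; rewrite -zip_map2 map_rot.
Qed.

Lemma ham_path_hamilton :
  hamilton_oriented_path D (map vtx (ham_path n E)) /\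
  sigma_plus D (map vtx (ham_path n E)) = forward_arcs E (ham_path n E).
Proof.
have [[_ Rs Ru Rn _] Rp] := ham_path_inv arcs_lt arcs_part feasible_exists.
have mp := augmented_multipartite arcs_lt arcs_part feasible_exists Rn.
set R := ham_path n E in Rs Ru Rn Rp mp *; split.
  apply/and3P; split.
  - rewrite sorted_map; apply: (@sub_in_sorted _ (mem R)) Rs; last exact/allP.
    move=> x y xR yR xy; case: smd => _ _ /= ->.
    exact: multipartite_arc mp xR yR xy.
  - rewrite map_inj_in_uniq // => x y /Rn xn /Rn yn /(congr1 rank).
    by rewrite !vtxK.
  - apply/forallP => x; rewrite -(rankK x) map_f // (perm_mem Rp) mem_iota.
    exact: rank_lt.
rewrite /sigma_plus /path_arcs behead_map zip_map2 count_map.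
apply: eq_in_count => -[x y] /mem_zip[/= /Rn xn /mem_behead/Rn yn].
by rewrite mem_arcs; move: xn yn; rewrite !unfold_in /= => -> ->.
Qed.

(** An oriented path becomes a directed path of the symmetric digraph, its backward arcs having cost
    0; there are no cycles. *)
Lemma hamilton_factor s : hamilton_oriented_path D s ->
  one_path_cycle_factor (hat D) (PathCycle s [::]) /\
  pc_cost (hat_cost D) (PathCycle s [::]) = sigma_plus D s.
Proof.
move=> /and3P[ss us /forallP sall]; split.
  rewrite /one_path_cycle_factor /pc_vertices /= cats0 us; apply/and3P; split.
  - by apply: contraTneq (sall x0) => ->.
  - apply: sub_sorted ss => x y; rewrite /underlying /hat /=.
    by case: (D x y) => //= ->.
  - exact/forallP.
rewrite /pc_cost /pc_arcs /= cats0 /sigma_plus -sum1_count [RHS]big_mkcond.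
by apply: eq_bigr => a _; rewrite /hat_cost.
Qed.

End Transfer.

(** * The algorithm runs in polynomial time *)

Lemma pt_allpairs A {eA : Enc A} X Y Z {eX : Enc X} {eY : Enc Y} {eZ : Enc Z}
    (f : A -> X -> Y -> Z) (s : A -> seq X) (t : A -> seq Y) :
  polytime s -> polytime t -> polytime (fun q : A * X * Y => f q.1.1 q.1.2 q.2) ->
  polytime (fun a => [seq f a x y | x <- s a, y <- t a]).
Proof.
move=> ps qt pf; apply: pt_flatten; apply: (pt_map (f := fun a x => [seq f a x y | y <- t a])) => //.
apply: (pt_map (f := fun (q : A * X) y => f q.1 q.2 y)) => //.
exact: (pt_comp (pt_fst pt_id) qt).
Qed.

Lemma pt_count_mem A {eA : Enc A} (x : A -> nat) (s : A -> seq nat) :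
  polytime x -> polytime s -> polytime (fun a => count_mem (x a) (s a)).
Proof.
move=> px ps; apply: (pt_count (p := fun a y => y == x a)) => //.
by apply: pt_eqn; [exact: (pt_snd pt_id) | exact: (pt_comp (pt_fst pt_id) px)].
Qed.

Lemma pt_memn A {eA : Enc A} (x : A -> nat) (s : A -> seq nat) :
  polytime x -> polytime s -> polytime (fun a => x a \in s a).
Proof.
by apply: pt_mem; apply: pt_eqn; [exact: (pt_fst pt_id) | exact: (pt_snd pt_id)].
Qed.

Lemma pt_mem_arc A {eA : Enc A} (x : A -> nat * nat) (s : A -> seq (nat * nat)) :
  polytime x -> polytime s -> polytime (fun a => x a \in s a).
Proof.
apply: pt_mem; apply: (@pt_ext _ _ _ _
  (fun p : (nat * nat) * (nat * nat) => (p.1.1 == p.2.1) && (p.1.2 == p.2.2))) => [[[a b] [c d]] //|].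
by apply: pt_andb; apply: pt_eqn; pt_auto.
Qed.

(** Under [map], [filter] and the like the argument becomes a tuple that contains the outer one. The
    second alternative composes a hypothesis on the outer argument with the projection. *)
Ltac pt_rule := cbv beta; first
  [ pt_step
  | match goal with
    | H : polytime ?n |- polytime (fun q => ?n (@?g q)) => apply: (pt_comp (f := g) _ H)
    end
  | lazymatch goal with
    | |- polytime (fun a => (@?f a).+1) => apply: (pt_succn (n := f))
    | |- polytime (fun a => (@?f a).-1) => apply: (pt_predn (n := f))
    | |- polytime (fun a => @?f a + @?g a) => apply: (pt_addn (m := f) (n := g))
    | |- polytime (fun a => @?f a * @?g a) => apply: (pt_muln (m := f) (n := g))
    | |- polytime (fun a => @?f a <= @?g a) => apply: (pt_leq (m := f) (n := g))
    | |- polytime (fun a => @eq_op _ (@?f a) (@?g a)) => apply: (pt_eqn (m := f) (n := g))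
    | |- polytime (fun a => ~~ (@?f a)) => apply: (pt_negb (b := f))
    | |- polytime (fun a => @?f a && @?g a) => apply: (pt_andb (b := f) (c := g))
    | |- polytime (fun a => @?f a || @?g a) => apply: (pt_orb (b := f) (c := g))
    | |- polytime (fun a => @?f a ++ @?g a) => apply: (pt_cat (s := f) (t := g))
    | |- polytime (fun a => rev (@?f a)) => apply: (pt_rev (l := f))
    | |- polytime (fun a => size (@?f a)) => apply: (pt_size (l := f))
    | |- polytime (fun a => behead (@?f a)) => apply: (pt_behead (l := f))
    | |- polytime (fun a => head (@?f a) (@?g a)) => apply: (pt_head (x0 := f) (l := g))
    | |- polytime (fun a => nth (@?f a) (@?g a) (@?h a)) => apply: (pt_nth (x0 := f) (l := g) (i := h))
    | |- polytime (fun a => take (@?f a) (@?g a)) => apply: (pt_take (i := f) (l := g))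
    | |- polytime (fun a => drop (@?f a) (@?g a)) => apply: (pt_drop (i := f) (l := g))
    | |- polytime (fun a => iota 0 (@?f a)) => apply: (pt_iota (n := f))
    | |- polytime (fun a => flatten (@?f a)) => apply: (pt_flatten (l := f))
    | |- polytime (fun a => map (@?f a) (@?g a)) => apply: (pt_map (f := f) (l := g))
    | |- polytime (fun a => filter (@?f a) (@?g a)) => apply: (pt_filter (p := f) (l := g))
    | |- polytime (fun a => all (@?f a) (@?g a)) => apply: (pt_all (p := f) (l := g))
    | |- polytime (fun a => count (@?f a) (@?g a)) =>
        first [apply: pt_count_mem | apply: (pt_count (p := f) (l := g))]
    | |- polytime (fun a => in_mem (@?f a) (@?g a)) => first [apply: pt_memn | apply: pt_mem_arc]
    | |- polytime (fun a => if _ then _ else _) => apply: pt_if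
    end ].
Ltac pt_solve := repeat pt_rule.

(** * Running time of the auction *)

Lemma pt_weight A {eA : Enc A} (n : A -> nat) (E : A -> seq (nat * nat))
    (x y : A -> nat) :
  polytime n -> polytime E -> polytime x -> polytime y ->
  polytime (fun a => weight (n a) (E a) (x a) (y a)).
Proof. by move=> pn pE px py; rewrite /weight /base_weight; pt_solve. Qed.

Lemma pt_best_object A {eA : Enc A} (n : A -> nat) (E : A -> seq (nat * nat))
   (U log : A -> seq nat) (x : A -> nat) :
  polytime n -> polytime E -> polytime U -> polytime log -> polytime x ->
  polytime (fun a => best_object 0 (weight (n a) (E a)) (U a) (log a) (x a)).
Proof.
by move=> pn pE pU pl px; rewrite /best_object; pt_solve; apply: pt_weight; pt_solve.
Qed.

Lemma pt_bid A {eA : Enc A} (n : A -> nat) (E : A -> seq (nat * nat))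
   (U : A -> seq nat) (st : A -> seq nat * seq (nat * nat) * seq nat) :
  polytime n -> polytime E -> polytime U -> polytime st ->
  polytime (fun a => bid 0 (weight (n a) (E a)) (U a) (st a)).
Proof.
move=> pn pE pU ps.
pose g a x (others : seq nat) :=
  let y := best_object 0 (weight (n a) (E a)) (U a) (st a).2 x in
  ([seq b.1 | b <- (st a).1.2 & b.2 == y] ++ others,
   (x, y) :: [seq b <- (st a).1.2 | b.2 != y], y :: (st a).2).
apply: (@pt_ext _ _ _ _ (fun a => if (st a).1.1 is x :: l then g a x l else st a)).
  by rewrite /g => a; case: (st a) => [[[|x l] B] log].
apply: (pt_case (g := g)) => //; first by pt_solve.
by rewrite /g; pt_solve; apply: pt_best_object; pt_solve.
Qed.

Lemma sz_mem (X : eqType) {eX : Enc X} (x : X) s : x \in s -> sz x < sz s.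
Proof.
elim: s => //= y s IH; rewrite inE sz_cons => /orP[/eqP -> | /IH]; lia.
Qed.

Lemma pb_pt A {eA : Enc A} B {eB : Enc B} (f : A -> B) :
  polytime f -> poly_bounded (fun a => sz (f a)).
Proof. by case. Qed.

Lemma pb_nat A {eA : Enc A} (f : A -> nat) : polytime f -> poly_bounded f.
Proof. by move=> /pb_pt pf; apply: (pb_le pf) => a; rewrite sz_nat -addnn; lia. Qed.

Lemma pb_succn A {eA : Enc A} (f : A -> nat) : poly_bounded f -> poly_bounded (fun a => (f a).+1).
Proof. by move=> pf; apply: (pb_le (pb_add pf (pb_const 1))) => a; rewrite addn1. Qed.

Ltac pb_solve := repeat (cbv beta; lazymatch goal with
  | |- poly_bounded (fun _ => ?c) => exact: pb_const
  | |- poly_bounded (fun a => @?f a + @?g a) => apply: (pb_add (f := f) (g := g))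
  | |- poly_bounded (fun a => @?f a * @?g a) => apply: (pb_mul (f := f) (g := g))
  | |- poly_bounded (fun a => (@?f a).+1) => apply: (pb_succn (f := f))
  | |- poly_bounded (fun a => sz (@?f a)) => apply: (pb_pt (f := f)); try assumption
  | |- poly_bounded ?f => apply: (pb_nat (f := f)); assumption
  end).

Lemma sz_nats_le (s : seq nat) m k :
  {in s, forall x, x <= m} -> size s <= k -> sz s <= k * (m + m + 2) + 1.
Proof.
move=> sm sk; apply: leq_trans (sz_seq_le (b := m.*2.+1) _) _.
  by apply/allP => x /sm xm; rewrite sz_nat ltnS leq_double.
by rewrite addn1 ltnS leq_mul //; lia.
Qed.

Lemma sz_arcs_le (s : seq (nat * nat)) m k :
  {in s, forall a, a.1 <= m /\ a.2 <= m} -> size s <= k ->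
  sz s <= k * (4 * m + 4) + 1.
Proof.
move=> sm sk; apply: leq_trans (sz_seq_le (b := 4 * m + 3) _) _.
  by apply/allP => -[x y] /sm[/= xm ym]; rewrite sz_pair !sz_nat; lia.
by rewrite addn1 ltnS leq_mul //; lia.
Qed.

(** The auction invariants keep all entries at most [n] and bound the lengths of the three lists. *)
Lemma sz_auction_state n E k :
  sz (iter k (bid 0 (weight n E) (iota 0 n.+1)) (iota 0 n.+1, [::], [::]))
  <= (n.+1 * (n + n + 2) + 1) + (n.+1 * (4 * n + 4) + 1)
           + (n.+1 * (n.+2 * n.+3).+1 * (n + n + 2) + 1) + 2.
Proof.
have wle x y : weight n E x y <= n.+2 * n.+3 by rewrite leq_mul2l base_weight_le orbT.
have iv := auction_state_inv 0 (iota_uniq 0 n.+1) wle k.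
have := log_bound iv; case: iv.
case: (iter _ _ _) => [[Q B] log] + uB + + _ _; rewrite [_.1.1]/= [_.1.2]/= [_.2]/=.
move=> pU sB lB logle.
have U_le x : x \in iota 0 n.+1 -> x <= n by rewrite mem_iota.
have szU := perm_size pU; rewrite size_cat !size_map size_iota in szU.
have szQ : sz Q <= n.+1 * (n + n + 2) + 1.
  apply: sz_nats_le; last by rewrite -szU leq_addr.
  by move=> x xQ; apply: U_le; rewrite -(perm_mem pU) mem_cat xQ.
have szB : sz B <= n.+1 * (4 * n + 4) + 1.
  apply: sz_arcs_le; last by rewrite -szU leq_addl.
  move=> a aB; split; apply: U_le; last by apply/sB/map_f.
  by rewrite -(perm_mem pU) mem_cat map_f ?orbT.
have szl : sz log <= n.+1 * (n.+2 * n.+3).+1 * (n + n + 2) + 1.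
  by apply: sz_nats_le; [move=> x /lB/sB/U_le | rewrite size_iota in logle].
rewrite !sz_pair; move: szQ szB szl; clear; lia.
Qed.

Lemma pt_assignment A {eA : Enc A} (n : A -> nat) (E : A -> seq (nat * nat)) :
  polytime n -> polytime E -> polytime (fun a => assignment (n a) (E a)).
Proof.
move=> pn pE; rewrite /assignment /auction; do 2!pt_rule.
apply: (pt_iter (step := fun a => bid 0 (weight (n a) (E a)) (iota 0 (n a).+1))).
- by pt_solve.
- by pt_solve.
- by apply: pt_bid; pt_solve.
exists (fun a => ((n a).+1 * (n a + n a + 2) + 1) + ((n a).+1 * (4 * n a + 4) + 1)
    + ((n a).+1 * ((n a).+2 * (n a).+3).+1 * (n a + n a + 2) + 1) + 2).
  by pb_solve.
by move=> a i _; apply: sz_auction_state.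
Qed.

(** * Running time of the orbit computation *)

Lemma pt_successor A {eA : Enc A} (F : A -> seq (nat * nat)) (x : A -> nat) :
  polytime F -> polytime x -> polytime (fun a => successor (F a) (x a)).
Proof. by move=> pF px; rewrite /successor; pt_solve. Qed.

Lemma sz_successor F x : sz (successor F x) <= sz F.
Proof.
rewrite /successor; case fE: filter => [|b l] /=.
  by rewrite sz_nat; apply: sz_gt0.
have : b \in b :: l by rewrite mem_head.
rewrite -fE mem_filter => /andP[_ /sz_mem/ltnW]; apply: leq_trans.
by case: b {fE} => b1 b2; rewrite sz_pair leqW ?leq_addl.
Qed.

Lemma sz_orbit_iter F x k :
  sz (iter k (orbit_step F x) [:: x]) <= k * (sz F).+1 + (sz x).+2.
Proof.
elim: k => [|k IH]; first by rewrite sz_cons sz_nil; lia.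
rewrite iterS; set l := iter k _ _ in IH *; rewrite /orbit_step mulSn.
case: ifP => _; first by move: IH; lia.
by rewrite sz_cons; have := sz_successor F (head x l); move: IH; lia.
Qed.

Lemma sz_orbit_of n F x : sz (orbit_of n F x) <= n * (sz F).+1 + (sz x).+2.
Proof. by rewrite sz_rev sz_orbit_iter. Qed.

Lemma pt_orbit_of A {eA : Enc A} (n : A -> nat) (F : A -> seq (nat * nat)) (x : A -> nat) :
  polytime n -> polytime F -> polytime x -> polytime (fun a => orbit_of (n a) (F a) (x a)).
Proof.
move=> pn pF px; rewrite /orbit_of; apply: pt_rev.
apply: (pt_iter (step := fun a => orbit_step (F a) (x a)) pn).
- by pt_solve.
- by rewrite /orbit_step; pt_solve; apply: pt_successor; pt_solve.
exists (fun a => n a * (sz (F a)).+1 + (sz (x a)).+2); first by pb_solve.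
move=> a i ia; apply: leq_trans (sz_orbit_iter _ _ _) _.
by rewrite leq_add2r leq_mul2r ia orbT.
Qed.

(** * Running time of the search and of the whole construction *)

Lemma pt_zip_behead A {eA : Enc A} (s : A -> seq nat) :
  polytime s -> polytime (fun a => zip (s a) (behead (s a))).
Proof.
move=> ps; apply: (@pt_ext _ _ _ _ (fun a =>
  [seq (nth 0 (s a) i, nth 0 (s a) i.+1) | i <- iota 0 (size (s a)).-1])); last by pt_solve.
move=> a; have szE : size (zip (s a) (behead (s a))) = (size (s a)).-1.
  by rewrite size_zip size_behead; apply/minn_idPr/leq_pred.
apply: (@eq_from_nth _ (0, 0)); first by rewrite size_map size_iota szE.
move=> i; rewrite size_map size_iota => i_s.
rewrite (nth_map 0) ?size_iota // nth_iota // add0n nth_zip_cond szE i_s.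
by rewrite nth_behead.
Qed.

Lemma pt_forward_arcs A {eA : Enc A} (E : A -> seq (nat * nat)) (s : A -> seq nat) :
  polytime E -> polytime s -> polytime (fun a => forward_arcs (E a) (s a)).
Proof.
move=> pE ps; rewrite /forward_arcs.
apply: (pt_count (p := fun a b => b \in E a)); first exact: pt_zip_behead.
by pt_solve.
Qed.

Lemma pt_sorted A {eA : Enc A} (F : A -> seq (nat * nat)) (s : A -> seq nat) :
  polytime F -> polytime s -> polytime (fun a => sorted (fun x y => (x, y) \in F a) (s a)).
Proof.
move=> pF ps; apply: (@pt_ext _ _ _ _ (fun a =>
  all (fun b => (b.1, b.2) \in F a) (zip (s a) (behead (s a))))).
  by move=> a; rewrite sorted_zip.
apply: (pt_all (p := fun a b => (b.1, b.2) \in F a)); first exact: pt_zip_behead.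
by pt_solve.
Qed.

Lemma pt_insertions A {eA : Enc A} (c : A -> seq nat * nat) :
  polytime c -> polytime (fun a => insertions (c a)).
Proof. by move=> pc; rewrite /insertions; pt_solve. Qed.

Lemma pt_exchanges A {eA : Enc A} (F : A -> seq (nat * nat)) (c : A -> seq nat * nat) :
  polytime F -> polytime c -> polytime (fun a => exchanges (fun x y => (x, y) \in F a) (c a)).
Proof. by move=> pF pc; rewrite /exchanges; pt_solve; apply: pt_sorted; pt_solve. Qed.

Lemma pt_grow A {eA : Enc A} (F : A -> seq (nat * nat)) (cs : A -> seq (seq nat * nat)) :
  polytime F -> polytime cs -> polytime (fun a => grow (fun x y => (x, y) \in F a) (cs a)).
Proof.
move=> pF pcs; rewrite /grow.
apply: (pt_case (g := fun a c (_ : seq (seq nat * nat)) => c :: cs a)); last by pt_solve.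
  by pt_solve; apply: pt_exchanges; pt_solve.
by [].
Qed.

(** The size of a list is a sum over its elements. All configurations of one search have the same
    contents and therefore the same size. *)
Lemma sz_perm T {eT : Enc T} (U : eqType) (f : U -> T) (s t : seq U) :
  perm_eq s t -> sz (map f s) = sz (map f t).
Proof.
have szE (l : seq U) : sz (map f l) = (\sum_(x <- l) (sz (f x)).+1).+1.
  by elim: l => [|x l IH]; rewrite ?big_nil // big_cons /= sz_cons IH; lia.
by move=> st; rewrite !szE (perm_big _ st).
Qed.

Lemma pt_reach A {eA : Enc A} (F : A -> seq (nat * nat)) (c : A -> seq nat * nat) :
  polytime F -> polytime c -> polytime (fun a => reach (fun x y => (x, y) \in F a) (c a)).
Proof.
move=> pF pc; rewrite /reach.
apply: (pt_iter (step := fun a => grow (fun x y => (x, y) \in F a))).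
- by pt_solve.
- by pt_solve.
- by apply: pt_grow; pt_solve.
have psz : polytime (fun a => size (c a).1) by pt_solve.
exists (fun a => (size (c a).1).+2 * (sz (c a)).+1 + 1); first by pb_solve.
move=> a i ia; set e := fun x y => _.
apply: leq_trans (sz_seq_le (b := sz (c a)) _) _.
  have szE (x : seq nat * nat) : sz x = sz (map id (contents x)).
    by case: x => R v; rewrite map_id sz_pair sz_cons addnC.
  by apply/allP => d /grow_perm dc; rewrite !szE (sz_perm _ dc).
rewrite addn1 ltnS leq_mul2r /=; apply: leq_trans (size_grow _ _ _) _.
by rewrite ltnS.
Qed.

Lemma pt_starts A {eA : Enc A} (P C : A -> seq nat) :
  polytime P -> polytime C -> polytime (fun a => starts 0 (P a) (C a)).
Proof.
move=> pP pC; rewrite /starts.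
apply: (pt_allpairs (f := fun a j i =>
  (take j (P a) ++ behead (rot i (C a)) ++ drop j (P a), nth 0 (C a) i))).
- by pt_solve.
- by pt_solve.
- by rewrite /rot; pt_solve.
Qed.

Lemma pt_merge_cycle A {eA : Enc A} (F : A -> seq (nat * nat)) (P C : A -> seq nat) :
  polytime F -> polytime P -> polytime C ->
  polytime (fun a => merge_cycle 0 (fun x y => (x, y) \in F a) (P a) (C a)).
Proof.
move=> pF pP pC; rewrite /merge_cycle /candidates.
apply: pt_head; first exact: pt_const.
apply: (pt_filter (p := fun a => sorted (fun x y => (x, y) \in F a))).
  apply: pt_flatten; apply: (pt_map (f := fun _ => @insertions _)).
    apply: pt_flatten; apply: (pt_map (f := fun a => reach (fun x y => (x, y) \in F a))).
      exact: pt_starts.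
    by apply: pt_reach; pt_solve.
  by apply: pt_insertions; pt_solve.
by apply: pt_sorted; pt_solve.
Qed.

Lemma pt_absorb A {eA : Enc A} (n : A -> nat) (F G : A -> seq (nat * nat))
   (P : A -> seq nat) (x : A -> nat) :
  polytime n -> polytime F -> polytime G -> polytime P -> polytime x ->
  polytime (fun a => absorb (n a) (F a) (G a) (P a) (x a)).
Proof.
move=> pn pF pG pP px; rewrite /absorb; pt_solve.
by apply: pt_merge_cycle => //; apply: pt_orbit_of.
Qed.

Lemma sz_absorb n F G P x :
  sz (absorb n F G P x) <= sz P + sz (orbit_of n G x).
Proof.
rewrite /absorb; case: ifP => _; first exact: leq_addr.
have [->|/(sz_perm id)] := merge_cycle_perm 0 (fun y z => (y, z) \in F) P (orbit_of n G x).
  exact: leq_trans (sz_gt0 _) (leq_addr _ _).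
by rewrite !map_id => ->; rewrite -sz_cat.
Qed.

Lemma pt_ham_path A {eA : Enc A} (n : A -> nat) (E : A -> seq (nat * nat)) :
  polytime n -> polytime E -> polytime (fun a => ham_path (n a) (E a)).
Proof.
move=> pn pE; have pA := pt_assignment pn pE.
rewrite /ham_path.
apply: (pt_foldl (step := fun a => absorb (n a) (assignment (n a) (E a) ++ E a) (assignment (n a) (E a)))).
- by apply: pt_behead; apply: pt_orbit_of.
- by pt_solve.
- by apply: pt_absorb; pt_solve; exact: (pt_comp (pt_fst (pt_fst pt_id)) pA).
(* The second factor bounds one orbit; the first counts the initial path and up to [n a] absorbed
   orbits. *)
exists (fun a => (n a).+1 * (n a * (sz (assignment (n a) (E a))).+1 + (sz (n a)).+2)).
  by pb_solve.
move=> a i; set G := assignment _ _; set b := (X in _.+1 * X).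
have orb x : x <= n a -> sz (orbit_of (n a) G x) <= b.
  by move=> xn; apply: leq_trans (sz_orbit_of _ _ _) _; rewrite leq_add2l !sz_nat !ltnS leq_double.
have init : sz (behead (orbit_of (n a) G (n a))) <= b.
  by apply: leq_trans (orb _ (leqnn _)); rewrite -drop1 sz_drop.
have fold l P : {subset l <= iota 0 (n a)} ->
    sz (foldl (absorb (n a) (G ++ E a) G) P l) <= sz P + size l * b.
  elim: l P => [|x l IH] P ln /=; first by rewrite addn0.
  apply: leq_trans (IH _ (fun y yl => ln y (mem_behead (s := x :: l) yl))) _.
  rewrite mulSn addnA leq_add2r; apply: leq_trans (sz_absorb _ _ _ _ _) _.
  rewrite leq_add2l orb // ltnW //.
  by have := ln x (mem_head _ _); rewrite mem_iota.
apply: leq_trans (fold _ _ (fun y => @mem_take _ _ _ y)) _.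
rewrite mulSn leq_add // leq_mul2r size_take_min size_iota geq_minr orbT //.
Qed.

Lemma pt_arcs_of A {eA : Enc A} (M : A -> seq (seq bool)) :
  polytime M -> polytime (fun a => arcs_of (M a)).
Proof.
move=> pM; rewrite /arcs_of.
apply: (pt_filter (p := fun a b => nth false (nth [::] (M a) b.1) b.2)); last by pt_solve.
by apply: (pt_allpairs (f := fun _ => pair)); pt_solve.
Qed.

Lemma pt_solve_matrix : polytime solve.
Proof.
have pE : polytime arcs_of by apply: pt_arcs_of; exact: pt_id.
have pS : polytime (fun M : seq (seq bool) => size M) by apply/pt_size/pt_id.
by apply: pt_pair; [apply: pt_forward_arcs => //|]; apply: pt_ham_path.
Qed.

(** * The theorem *)

Section Optimum.
Variables (p : nat) (V : finType) (D : rel V) (part : V -> 'I_p).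
Hypothesis smd : semicomplete_multipartite D part.
Hypothesis balanced : 2 * (\max_(i < p) #|partite_set part i|)
  <= (\sum_(i < p) #|partite_set part i|) + 1.

(** The computed path bounds the cost of every factor and, by [hamilton_factor], is itself a factor.
    So its value is both maxima at once. *)
Lemma solve_optimal : exists P,
  [/\ enc (solve (adjacency_matrix D)) =
        Node (encode_nat (solve (adjacency_matrix D)).1) (encode_path P),
      hamilton_oriented_path D P,
      sigma_plus D P = (solve (adjacency_matrix D)).1,
      is_sigma_hp_max D (sigma_plus D P) & is_c_pc_max D (sigma_plus D P)].
Proof.
have [x0 _] : exists x : V, true.
  case: smd => p2 /(_ (Ordinal (ltnW p2)))/set0Pn[x _] _; by exists x.
have [hamP sigP] := ham_path_hamilton smd balanced x0.
set R := ham_path _ _ in hamP sigP; exists (map (nth x0 (enum V)) R).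
have le_sig F : one_path_cycle_factor (hat D) F ->
    pc_cost (hat_cost D) F <= sigma_plus D (map (nth x0 (enum V)) R).
  by rewrite sigP; apply: factor_cost_le smd balanced x0 F.
have solveE : solve (adjacency_matrix D) = (forward_arcs (arcs_of (adjacency_matrix D)) R, R).
  by rewrite /solve size_matrix.
have [facP costP] := hamilton_factor x0 hamP.
split=> //.
- rewrite solveE /=; congr (Node _ _); rewrite /encode_path /enc /enc_list -map_comp.
  have [[_ _ _ Rn _] _] := ham_path_inv (@arcs_lt V D x0) (arcs_part smd x0) (feasible_exists smd balanced x0).
  congr encode_seq; apply/eq_in_map => i /Rn iR /=; congr encode_nat.
  by rewrite -[LHS](vtxK x0 iR).
- by rewrite solveE sigP.
- split; first by exists (map (nth x0 (enum V)) R).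
  by move=> s /(hamilton_factor x0)[/le_sig + <-].
- by split; [exists (PathCycle (map (nth x0 (enum V)) R) [::]) | exact: le_sig].
Qed.

End Optimum.

Lemma encode_digraphE (V : finType) (D : rel V) :
  encode_digraph D = enc (adjacency_matrix D).
Proof.
rewrite /encode_digraph /adjacency_matrix /enc /enc_list -map_comp.
by congr encode_seq; apply: eq_map => x /=; rewrite /enc -map_comp.
Qed.

Lemma sz_adjacency_matrix (V : finType) (D : rel V) :
  (sz (adjacency_matrix D)).+1 <= 8 * (digraph_size D + 1) ^ 2.
Proof.
have row : {in adjacency_matrix D, forall r, sz r <= #|V| * 4 + 1}.
  move=> r /mapP[x _ ->]; apply: leq_trans (sz_seq_le (b := 3) _) _.
    by apply/allP => b _; apply: sz_bool.
  by rewrite size_map -cardE addn1.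
apply: (@leq_trans ((#|V| * (#|V| * 4 + 1).+1).+1).+1).
  rewrite ltnS; apply: leq_trans (sz_seq_le (b := #|V| * 4 + 1) _) _; first by apply/allP.
  by rewrite size_matrix.
have : #|V| <= digraph_size D by apply: leq_addr.
move: (digraph_size D) => m; rewrite -mulnn; nia.
Qed.

Theorem theorem1p3 :
  (forall (p : nat) (V : finType) (D : rel V) (part : V -> 'I_p),
     semicomplete_multipartite D part ->
     2 * (\max_(i < p) #|partite_set part i|)
       <= (\sum_(i < p) #|partite_set part i|) + 1 ->
     exists sigma c : nat,
       [/\ is_sigma_hp_max D sigma, is_c_pc_max D c & sigma = c])
  /\
  (exists (prog : program) (a k : nat),
     forall (p : nat) (V : finType) (D : rel V) (part : V -> 'I_p),
       semicomplete_multipartite D part ->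
       2 * (\max_(i < p) #|partite_set part i|)
         <= (\sum_(i < p) #|partite_set part i|) + 1 ->
       exists (sigma : nat) (P : seq V) (t : nat),
         [/\ is_sigma_hp_max D sigma,
             hamilton_oriented_path D P,
             sigma_plus D P = sigma,
             computes_in prog (encode_digraph D)
               (Node (encode_nat sigma) (encode_path P)) t &
             t <= a * digraph_size D ^ k + a]).
Proof.
split.
  move=> p V D part smd bal; have [P [_ _ _ sigmaP cP]] := solve_optimal smd bal.
  by exists (sigma_plus D P), (sigma_plus D P).
have [_ [c [m [tb [_ _ [k tbP] cP]]]]] := pt_solve_matrix.
(* For [d > 0], [8 * (d + 1) ^ 2] is at most [32 * d ^ 2], and the [k]-th power of this gives the
   coefficient and the exponent. *)
exists c, (32 ^ k), (2 * k) => p V D part smd bal.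
have [P [encP hamP sigP sigmaP _]] := solve_optimal smd bal.
have [|s [t [ex sE tt]]] := cP (adjacency_matrix D)
    (update (fun=> Leaf) 0 (encode_digraph D)).
  by rewrite encode_digraphE.
exists (sigma_plus D P), P, t; split=> //.
  by exists s; rewrite // sE encP sigP.
apply: leq_trans tt (leq_trans (tbP _) _).
set d := digraph_size D.
have d_gt0 : 0 < d.
  case: smd => p2 /(_ (Ordinal (ltnW p2)))/set0Pn[x _] _.
  by apply: leq_trans (leq_addr _ _); apply/card_gt0P; exists x.
apply: leq_trans (leq_addr _ _); rewrite expnM -expnMn.
have base : (sz (adjacency_matrix D)).+1 <= 32 * d ^ 2.
  apply: leq_trans (sz_adjacency_matrix D) _; rewrite -/d -!mulnn; nia.
by case: (k) => // k'; rewrite leq_exp2r.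
Qed.
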